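(* Let $K$ be a compact Hausdorff space and $n$ a positive integer. Let $\mathcal{M}(K)$ be the space of regular Borel signed measures on $K$, let $\mathcal{P}_o(^nC(K))$ be the space of orthogonally additive $n$-homogeneous polynomials on $C(K)$, and let $J_n\colon\mathcal{M}(K)\to\mathcal{P}_o(^nC(K))$ be given by $$(J_n\mu)(x)=\int_K x^n\,d\mu.$$ (a) For every $n$, $J_n$ is a Banach lattice isometric isomorphism from $(\mathcal{M}(K),\|\cdot\|_1)$ onto $(\mathcal{P}_o(^nC(K)),\|\cdot\|_r)$. (b) If $n$ is odd, then the regular and supremum norms coincide on $\mathcal{P}_o(^nC(K))$, and so $J_n$ is an isometric isomorphism for the supremum norm on $\mathcal{P}_o(^nC(K))$. (c) If $n$ is even, then $J_n$ is an isometric isomorphism for the norm on $\mathcal{M}(K)$ defined by $$\|\mu\|_0:=\max\{\|\mu^+\|_1,\|\mu^-\|_1\}$$ and the supremum norm on $\mathcal{P}_o(^nC(K))$.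
   Context: $C(K)$ is the Banach lattice of continuous real functions on $K$ with the supremum norm $\|\cdot\|_\infty$. $\mathcal{M}(K)$ carries its usual lattice structure; $\mu^+,\mu^-$ are the positive and negative parts of $\mu$ and $\|\mu\|_1=|\mu|(K)$ is the variation norm. An $n$-homogeneous polynomial on $C(K)$ is a function $P\colon C(K)\to\mathbb{R}$ of the form $P(x)=A(x,\dots,x)$ with $A$ a bounded $n$-linear form (taken to be the unique symmetric one). $P$ is orthogonally additive if $P(x+y)=P(x)+P(y)$ whenever $|x|\wedge|y|=0$. It is known that every orthogonally additive $n$-homogeneous polynomial on $C(K)$ is of the form $x\mapsto\int_K x^n\,d\mu$ for some $\mu\in\mathcal{M}(K)$. The supremum norm is $\|P\|_\infty=\sup\{|P(x)|:\|x\|_\infty\le1\}$. The $n$-homogeneous polynomials are ordered by: $\widehat A\le\widehat B$ if $A(x_1,\dots,x_n)\le B(x_1,\dots,x_n)$ for all $x_1,\dots,x_n\ge 0$, where $\widehat A(x)=A(x,\dots,x)$; this is the order used on $\mathcal{P}_o(^nC(K))$. Every orthogonally additive polynomial is regular (a difference of two positive $n$-homogeneous polynomials) and has an absolute value $|P|$ in this order, which for $P=\widehat A$ and $x\ge0$ satisfies $$|P|(x)=\sup\Bigl\{\sum_{i_1,\dots,i_n}|A(u^1_{i_1},\dots,u^n_{i_n})|: u^1,\dots,u^n\in\Pi(x)\Bigr\},$$ where $\Pi(x)$ is the set of all finite families of positive elements of $C(K)$ whose sum is $x$. The regular norm is $\|P\|_r=\|\,|P|\,\|_\infty$. *)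

(* Defs.v *)
From HB Require Import structures.
From mathcomp Require Import all_boot all_order all_algebra all_fingroup.
From mathcomp Require Import all_classical all_reals all_analysis.
From mathcomp Require Import ring.

Set Implicit Arguments.
Unset Strict Implicit.
Unset Printing Implicit Defensive.

Import Order.TTheory GRing.Theory Num.Theory.
Import numFieldNormedType.Exports.

Local Open Scope classical_set_scope.
Local Open Scope ring_scope.

Section normed_lattices.
Context {R : realType}.
Implicit Types E F : lmodType R.

Definition is_norm E (N : E -> R) :=
  [/\ forall x, 0 <= N x,
      forall x, N x = 0 -> x = 0,
      forall a x, N (a *: x) = `|a| * N x
    & forall x y, N (x + y) <= N x + N y].

Definition norm_complete E (N : E -> R) :=
  forall u : nat -> E,
    (forall e, 0 < e -> exists m, forall i j,
       (m <= i)%N -> (m <= j)%N -> N (u i - u j) < e) ->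
    exists l, forall e, 0 < e -> exists m, forall i,
       (m <= i)%N -> N (u i - l) < e.

Definition is_join E (le : E -> E -> Prop) (x y s : E) :=
  [/\ le x s, le y s & forall z, le x z -> le y z -> le s z].

Definition is_meet E (le : E -> E -> Prop) (x y s : E) :=
  [/\ le s x, le s y & forall z, le z x -> le z y -> le z s].

Record vector_lattice E (le : E -> E -> Prop) : Prop := {
  vl_refl : forall x, le x x ;
  vl_anti : forall x y, le x y -> le y x -> x = y ;
  vl_trans : forall x y z, le x y -> le y z -> le x z ;
  vl_add : forall x y z, le x y -> le (x + z) (y + z) ;
  vl_scale : forall a x y, 0 <= a -> le x y -> le (a *: x) (a *: y) ;
  vl_join : forall x y, exists s, is_join le x y s ;
  vl_meet : forall x y, exists s, is_meet le x y s }.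

(* The absolute value of x is the join of x and - x. *)
Record banach_lattice E (le : E -> E -> Prop) (N : E -> R) : Prop := {
  bl_lattice : vector_lattice le ;
  bl_norm : is_norm N ;
  bl_mono : forall x y x' y', is_join le x (- x) x' -> is_join le y (- y) y' ->
    le x' y' -> N x <= N y ;
  bl_complete : norm_complete N }.

Definition lattice_hom E F (leE : E -> E -> Prop) (leF : F -> F -> Prop)
    (T : E -> F) :=
  (forall x y s, is_join leE x y s -> is_join leF (T x) (T y) (T s)) /\
  (forall x y s, is_meet leE x y s -> is_meet leF (T x) (T y) (T s)).

Definition isometric_isomorphism E F (NE : E -> R) (NF : F -> R) (T : E -> F) :=
  [/\ is_norm NE, is_norm NF, linear T, bijective T & forall x, NF (T x) = NE x].

Definition banach_lattice_isometric_isomorphism E F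
    (leE : E -> E -> Prop) (NE : E -> R) (leF : F -> F -> Prop) (NF : F -> R)
    (T : E -> F) :=
  [/\ banach_lattice leE NE, banach_lattice leF NF, lattice_hom leE leF T
    & isometric_isomorphism NE NF T].

End normed_lattices.

Section continuous_functions.
Context {R : realType} {K : topologicalType}.
Implicit Types x y : continuousType K R.

Let add_cts x y : continuous ((fun t => x t + y t) : K -> R).
Proof. by move=> t; apply: cvgD; exact: cts_fun. Qed.

Let opp_cts x : continuous ((fun t => - x t) : K -> R).
Proof. by move=> t; apply: cvgN; exact: cts_fun. Qed.

Let scale_cts (a : R) x : continuous ((fun t => a * x t) : K -> R).
Proof. by move=> t; apply: cvgM; [exact: cvg_cst|exact: cts_fun]. Qed.

Definition C_zero : continuousType K R := cst 0.
Definition C_add x y : continuousType K R := mkcts (@add_cts x y).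
Definition C_opp x : continuousType K R := mkcts (@opp_cts x).
Definition C_scale (a : R) x : continuousType K R := mkcts (@scale_cts a x).

Let C_addA : associative C_add.
Proof. by move=> x y z; apply/continuousEP => t; exact: addrA. Qed.

Let C_addC : commutative C_add.
Proof. by move=> x y; apply/continuousEP => t; exact: addrC. Qed.

Let C_add0 : left_id C_zero C_add.
Proof. by move=> x; apply/continuousEP => t; exact: add0r. Qed.

Let C_addN : left_inverse C_zero C_opp C_add.
Proof. by move=> x; apply/continuousEP => t; exact: addNr. Qed.

HB.instance Definition _ := GRing.isZmodule.Build (continuousType K R)
  C_addA C_addC C_add0 C_addN.

Let C_scaleA a b x : C_scale a (C_scale b x) = C_scale (a * b) x.
Proof. by apply/continuousEP => t; exact: mulrA. Qed.

Let C_scale1 : left_id 1 C_scale.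
Proof. by move=> x; apply/continuousEP => t; exact: mul1r. Qed.

Let C_scaleDr : right_distributive C_scale +%R.
Proof. by move=> a x y; apply/continuousEP => t; exact: mulrDr. Qed.

Let C_scaleDl x : {morph C_scale^~ x : a b / a + b}.
Proof. by move=> a b; apply/continuousEP => t; exact: mulrDl. Qed.

HB.instance Definition _ := GRing.Zmodule_isLmodule.Build R (continuousType K R)
  C_scaleA C_scale1 C_scaleDr C_scaleDl.

Definition C_norm x : R := sup [set `|x t| | t in [set: K]].

End continuous_functions.

Section signed_measures.
Context d (T : measurableType d) (R : realType).
Implicit Types mu : {charge set T -> \bar R}.

Definition hahn mu : {PN | hahn_decomposition mu PN.1 PN.2}.
Proof. by apply: cid; have [P [N PN]] := Hahn_decomposition mu; exists (P, N). Defined.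

(* jordan_pos, jordan_neg and charge_variation do not depend on the chosen Hahn
   decomposition, by Hahn_decomposition_uniq. *)
Definition charge_pos mu : {finite_measure set T -> \bar R} :=
  jordan_pos (svalP (hahn mu)).
Definition charge_neg mu : {finite_measure set T -> \bar R} :=
  jordan_neg (svalP (hahn mu)).
Definition charge_abs mu : {measure set T -> \bar R} :=
  charge_variation (svalP (hahn mu)).

Definition tv_norm mu : R := fine (charge_abs mu setT).

Definition max_norm mu : R :=
  Num.max (tv_norm (charge_pos mu)) (tv_norm (charge_neg mu)).

Definition charge_integral mu (f : T -> R) : R :=
  \int[charge_pos mu]_t f t - \int[charge_neg mu]_t f t.

End signed_measures.

Section regular_measures.
Context (R : realType) (K : ptopologicalType).

Definition borel := g_sigma_algebraType (@open K).

(* On a compact Hausdorff space the closed sets are the compact sets. *)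
Definition regular (mu : {charge set borel -> \bar R}) :=
  forall A : set borel, measurable A -> forall e : R, 0 < e ->
    exists C U : set K, [/\ closed C, open U, C `<=` A, A `<=` U
      & (charge_abs mu (U `\` C) < e%:E)%E].

(* A charge is a function on all the subsets of its carrier; the last field
   makes equality of measures the same as equality on the Borel sets. *)
Record regular_measure := RegularMeasure {
  rm_charge :> {charge set borel -> \bar R} ;
  rm_regular : regular rm_charge ;
  rm_off_borel : forall A : set borel, ~ measurable A -> rm_charge A = 0%E }.


Lemma regular_measureP (mu nu : regular_measure) :
  (forall A, mu A = nu A) -> mu = nu.
Proof.
case: mu nu => [[m mc] mr m0] [[n nc] nr n0] /= /funext mn.
subst n; have cE : mc = nc.
  case: mc nc {mr m0 nr n0} => [[a1] [a2] [a3]] [[b1] [b2] [b3]].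
  by rewrite (Prop_irrelevance a1 b1) (Prop_irrelevance a2 b2)
    (Prop_irrelevance a3 b3).
subst nc; by rewrite (Prop_irrelevance mr nr) (Prop_irrelevance m0 n0).
Qed.

Lemma regular_measure_fin (mu : regular_measure) A : mu A \is a fin_num.
Proof.
have [mA|mA] := pselect (measurable (A : set borel)).
  exact: fin_num_measure.
by rewrite rm_off_borel.
Qed.

Lemma charge_abs_min (mu : {charge set borel -> \bar R})
    (la : {measure set borel -> \bar R}) :
  (forall A, measurable A -> (`|mu A| <= la A)%E) ->
  forall A, measurable A -> (charge_abs mu A <= la A)%E.
Proof.
move=> le_la A mA; have [[mP _] [mN _] PN PN0] := svalP (hahn mu).
set P := (sval (hahn mu)).1 in mP PN PN0; set N := (sval (hahn mu)).2 in mN PN PN0.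
have -> : la A = (la (A `&` P) + la (A `&` N))%E.
  rewrite -measureU//; [|exact: measurableI|exact: measurableI|].
    by rewrite -setIUr PN setIT.
  by rewrite setIACA PN0 setI0.
rewrite /charge_abs/= /charge_variation/= jordan_posE jordan_negE.
rewrite cjordan_posE cjordan_negE /crestr0 mem_set// /crestr.
apply: leeD; first by apply: le_trans (lee_abs _) (le_la _ _); exact: measurableI.
apply: le_trans (lee_abs _) _; rewrite abseN; apply: le_la; exact: measurableI.
Qed.

Lemma open_borel (U : set K) : open U -> measurable (U : set borel).
Proof. by move=> oU; apply: sub_sigma_algebra. Qed.

Lemma closed_borel (C : set K) : closed C -> measurable (C : set borel).
Proof.
move=> cC; have : measurable (~` C : set borel).
  by apply: open_borel; exact: closed_openC.
by move=> /measurableC; rewrite setCK.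
Qed.

Lemma regular_dominated (mu nu1 nu2 : {charge set borel -> \bar R})
    (c : {nonneg R}) : regular nu1 -> regular nu2 ->
  (forall A : set borel, measurable A ->
    (`|mu A| <= c%:num%:E * (charge_abs nu1 A + charge_abs nu2 A))%E) ->
  regular mu.
Proof.
move=> r1 r2 le_mu A mA e e0.
pose c1 : R := c%:num + 1; have c10 : 0 < c1 by rewrite ltr_wpDl.
have e20 : 0 < e / c1 / 2 by rewrite !divr_gt0.
have [C1 [U1 [cC1 oU1 C1A AU1 lt1]]] := r1 A mA _ e20.
have [C2 [U2 [cC2 oU2 C2A AU2 lt2]]] := r2 A mA _ e20.
exists (C1 `|` C2), (U1 `&` U2); split; first exact: closedU.
- exact: openI.
- by rewrite subUset.
- by rewrite subsetI.
have mD C U : closed C -> open U -> measurable (U `\` C : set borel).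
  by move=> cC oU; apply: measurableD; [exact: open_borel|exact: closed_borel].
set D := (_ `\` _); have mDD : measurable (D : set borel).
  by apply: mD; [exact: closedU|exact: openI].
have D1 : D `<=` U1 `\` C1 by move=> t [[? ?]] /not_orP[].
have D2 : D `<=` U2 `\` C2 by move=> t [[? ?]] /not_orP[].
pose la := mscale c (measure_add (charge_abs nu1) (charge_abs nu2)).
have laE B : la B = (c%:num%:E * (charge_abs nu1 B + charge_abs nu2 B))%E.
  by rewrite -measure_addE.
have le_la : (charge_abs mu D <= la D)%E.
  apply: charge_abs_min => // B mB.
  by apply: le_trans (le_mu B mB) _; rewrite -laE.
apply: le_lt_trans le_la _; rewrite laE.
have lt3 : (charge_abs nu1 D + charge_abs nu2 D < (e / c1)%:E)%E.
  rewrite [e / c1]splitr EFinD; apply: lteD.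
    by apply: le_lt_trans lt1; apply: le_measure; rewrite ?inE//; exact: mD.
  by apply: le_lt_trans lt2; apply: le_measure; rewrite ?inE//; exact: mD.
apply: (@le_lt_trans _ _ (c%:num%:E * (e / c1)%:E)%E).
  by apply: lee_wpmul2l; [rewrite lee_fin|exact: ltW].
by rewrite -EFinM lte_fin mulrCA gtr_pMr// ltr_pdivrMr// mul1r /c1 ltrDl.
Qed.

Let regular0 : regular (czero : {charge set borel -> \bar R}).
Proof.
move=> A mA e e0; exists set0, setT; split => //; [exact: closed0|exact: openT|].
rewrite setD0; apply: le_lt_trans (_ : 0%:E < _)%E; last by rewrite lte_fin.
have := @charge_abs_min czero mzero; apply => // B mB.
by change (`|0 : \bar R| <= 0)%E; rewrite abse0.
Qed.

Let regularD (mu nu : regular_measure) : regular (cadd mu nu).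
Proof.
apply: (@regular_dominated _ mu nu 1%:nng); [exact: rm_regular..|] => A mA.
rewrite mul1e; apply: le_trans (lee_abs_add _ _) _.
by apply: leeD; exact: abse_charge_variation.
Qed.

Let regularZ a (mu : regular_measure) : regular (cscale a mu).
Proof.
apply: (@regular_dominated _ mu mu `|a|%:nng); [exact: rm_regular..|] => A mA.
rewrite /cscale abseM; apply: lee_wpmul2l => //.
apply: le_trans (abse_charge_variation (svalP (hahn mu)) mA) _.
exact: leeDl.
Qed.

Let regularN (mu : regular_measure) : regular (copp mu).
Proof.
apply: (@regular_dominated _ mu mu 1%:nng); [exact: rm_regular..|] => A mA.
rewrite /copp abseN mul1e.
apply: le_trans (abse_charge_variation (svalP (hahn mu)) mA) _.
exact: leeDl.
Qed.

Let off_borel0 (A : set borel) :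
  ~ measurable A -> (czero : {charge set borel -> \bar R}) A = 0%E.
Proof. by []. Qed.

Let off_borelD (mu nu : regular_measure) (A : set borel) :
  ~ measurable A -> cadd mu nu A = 0%E.
Proof. by move=> nA; rewrite /cadd !rm_off_borel// adde0. Qed.

Let off_borelZ a (mu : regular_measure) (A : set borel) :
  ~ measurable A -> cscale a mu A = 0%E.
Proof. by move=> nA; rewrite /cscale !rm_off_borel// mule0. Qed.

Let off_borelN (mu : regular_measure) (A : set borel) :
  ~ measurable A -> copp mu A = 0%E.
Proof. by move=> nA; rewrite /copp !rm_off_borel// oppe0. Qed.

Definition M_zero := RegularMeasure regular0 off_borel0.
Definition M_add mu nu := RegularMeasure (@regularD mu nu) (@off_borelD mu nu).
Definition M_opp mu := RegularMeasure (@regularN mu) (@off_borelN mu).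
Definition M_scale a mu := RegularMeasure (@regularZ a mu) (@off_borelZ a mu).

Let M_addA : associative M_add.
Proof. by move=> x y z; apply: regular_measureP => A; exact: addeA. Qed.

Let M_addC : commutative M_add.
Proof. by move=> x y; apply: regular_measureP => A; exact: addeC. Qed.

Let M_add0 : left_id M_zero M_add.
Proof. by move=> x; apply: regular_measureP => A; exact: add0e. Qed.

Let M_addN : left_inverse M_zero M_opp M_add.
Proof.
move=> x; apply: regular_measureP => A /=; rewrite /cadd /copp/= addeC subee//.
exact: regular_measure_fin.
Qed.

HB.instance Definition _ := gen_eqMixin regular_measure.
HB.instance Definition _ := gen_choiceMixin regular_measure.
HB.instance Definition _ := GRing.isZmodule.Build regular_measure
  M_addA M_addC M_add0 M_addN.

Let M_scaleA a b mu : M_scale a (M_scale b mu) = M_scale (a * b) mu.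
Proof. by apply: regular_measureP => A /=; rewrite /cscale EFinM muleA. Qed.

Let M_scale1 : left_id 1 M_scale.
Proof. by move=> mu; apply: regular_measureP => A; exact: mul1e. Qed.

Let M_scaleDr : right_distributive M_scale +%R.
Proof.
move=> a mu nu; apply: regular_measureP => A.
change (a%:E * (mu A + nu A) = a%:E * mu A + a%:E * nu A)%E.
by rewrite muleDr// fin_num_adde_defl// regular_measure_fin.
Qed.

Let M_scaleDl mu : {morph M_scale^~ mu : a b / a + b}.
Proof.
move=> a b; apply: regular_measureP => A.
change ((a + b)%:E * mu A = a%:E * mu A + b%:E * mu A)%E.
by rewrite EFinD muleDl// regular_measure_fin.
Qed.

HB.instance Definition _ := GRing.Zmodule_isLmodule.Build R regular_measure
  M_scaleA M_scale1 M_scaleDr M_scaleDl.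

Definition measure_le (mu nu : regular_measure) :=
  forall A : set borel, measurable A -> (mu A <= nu A)%E.

End regular_measures.

Section polynomials.
Context {R : realType} {K : topologicalType} (n : nat).
Local Notation C := (continuousType K R).
Implicit Types (A B : ('I_n -> C) -> R) (P Q : C -> R).

(* dfwith x i y is the family x with its i-th entry replaced by y. *)
Definition multilinear A := forall (i : 'I_n) (x : 'I_n -> C) (a : R) (y z : C),
  A (dfwith x i (a *: y + z)) = a * A (dfwith x i y) + A (dfwith x i z).

Definition symmetric_form A :=
  forall (s : 'S_n) (x : 'I_n -> C), A (fun i => x (s i)) = A x.

Definition bounded_form A :=
  exists c : R, forall x, `|A x| <= c * \prod_(i < n) C_norm (x i).

Definition form_of P A :=
  [/\ multilinear A, bounded_form A, symmetric_form A & forall x, P x = A (fun=> x)].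

Definition homogeneous_polynomial P := exists A, form_of P A.

(* A symmetric form is determined by its diagonal, so A and B are unique. *)
Definition poly_le P Q := exists A B,
  [/\ form_of P A, form_of Q B &
    forall x : 'I_n -> C, (forall i t, 0 <= x i t) -> A x <= B x].

Definition orthogonally_additive P := forall x y : C,
  (forall t, Num.min `|x t| `|y t| = 0) -> P (x + y) = P x + P y.

Definition poly_sup_norm P : R := sup [set `|P x| | x in [set x | C_norm x <= 1]].

(* The supremum of P and - P among all n-homogeneous polynomials. *)
Definition is_poly_abs P Q :=
  [/\ homogeneous_polynomial Q, poly_le P Q, poly_le (fun x => - P x) Q
    & forall S, homogeneous_polynomial S ->
        poly_le P S -> poly_le (fun x => - P x) S -> poly_le Q S].

Definition poly_abs P : C -> R := xget (fun=> 0) [set Q | is_poly_abs P Q].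

Definition poly_reg_norm P : R := poly_sup_norm (poly_abs P).

Definition oa_polynomial : {pred (C -> R^o)} :=
  [pred P | `[< homogeneous_polynomial P /\ orthogonally_additive P >]].

Let form_of0 : form_of (0 : C -> R^o) (fun=> 0).
Proof.
split=> //; first by move=> i x a y z; rewrite mulr0 addr0.
by exists 0 => x; rewrite normr0 mul0r.
Qed.

Let form_ofD (a : R) P Q A B : form_of P A -> form_of Q B ->
  form_of (fun x => a * P x + Q x) (fun x => a * A x + B x).
Proof.
move=> [mA [c cA] sA PA] [mB [d dB] sB QB]; split.
- by move=> i x b y z; rewrite mA mB; ring.
- exists (`|a| * c + d) => x; apply: le_trans (ler_normD _ _) _.
  by rewrite mulrDl normrM -mulrA lerD// ler_wpM2l.
- by move=> s x; rewrite sA sB.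
- by move=> x; rewrite PA QB.
Qed.

Let oa_polynomial_submod_closed : submod_closed oa_polynomial.
Proof.
split.
  apply/asboolP; split; first by exists (fun=> 0); exact: form_of0.
  by move=> x y _; rewrite addr0.
move=> a P Q /asboolP[[A PA] oP] /asboolP[[B QB] oQ]; apply/asboolP; split.
  by exists (fun x => a * A x + B x); exact: form_ofD.
move=> x y xy.
change (a * P (x + y) + Q (x + y) = (a * P x + Q x) + (a * P y + Q y)).
by rewrite oP// oQ//; ring.
Qed.

HB.instance Definition _ := GRing.isSubmodClosed.Build R (C -> R^o) oa_polynomial
  oa_polynomial_submod_closed.

Record oa_poly := OAPoly {
  oa_fun :> C -> R^o ; oa_funP : oa_fun \in oa_polynomial }.

HB.instance Definition _ := [isSub for oa_fun].
HB.instance Definition _ := [Choice of oa_poly by <:].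
HB.instance Definition _ := [SubChoice_isSubLmodule of oa_poly by <:].

End polynomials.

Section representation.
Context {R : realType} {K : ptopologicalType}.
Local Notation C := (continuousType K R).
Implicit Types (mu : regular_measure R K) (x y : C).

Definition power_integral n mu (x : C) : R :=
  charge_integral mu (fun t => x t ^+ n).

Section compact.
Hypothesis cK : compact [set: K].

Let C_norm_ub x t : `|x t| <= C_norm x.
Proof.
have /compact_bounded[M [_ xM]] : compact (x @` [set: K]).
  by apply: continuous_compact => //; apply: continuous_subspaceT; exact: cts_fun.
apply: ub_le_sup; last by exists t.
exists (M + 1) => _ [u _ <-]; apply: (xM (M + 1)); first by rewrite ltrDl.
by exists u.
Qed.

Let cts_integrable (la : {finite_measure set (borel K) -> \bar R}) (f : K -> R) :
  continuous f -> la.-integrable [set: borel K] (EFin \o f).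
Proof.
move=> cf; apply: measurable_bounded_integrable => //.
- by rewrite ltey_eq fin_num_measure.
- apply: (measurability _ (measurable_realfun.RGenOpens.measurableE R)) => _ [_ [a [b ->]] <-].
  rewrite setTI; apply: open_borel; apply: open_comp; last exact: interval_open.
  by move=> t _; exact: cf.
- have /compact_bounded[M [? fM]] : compact (f @` [set: K]).
    by apply: continuous_compact => //; exact: continuous_subspaceT.
  by exists M; split => // ? ? ? ?; exact: fM.
Qed.

Let charge_integralD mu (a : R) (f g : K -> R) : continuous f -> continuous g ->
  charge_integral mu (fun t => a * f t + g t) =
  a * charge_integral mu f + charge_integral mu g.
Proof.
move=> cf cg; rewrite /charge_integral.
have caf : continuous (fun t => a * f t).
  by move=> t; apply: cvgM; [exact: cvg_cst|exact: cf].
rewrite !RintegralD//; try exact: cts_integrable.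
by rewrite !RintegralZl//; try exact: cts_integrable; ring.
Qed.

Let charge_integral_le mu (f : K -> R) (c : R) : continuous f ->
  (forall t, `|f t| <= c) -> `|charge_integral mu f| <= tv_norm mu * c.
Proof.
move=> cf fc; rewrite /charge_integral.
have cnf : continuous (fun t => `|f t|).
  by move=> t; apply: cvg_norm; exact: cf.
have le_c (la : {finite_measure set (borel K) -> \bar R}) :
    `|\int[la]_t f t| <= c * fine (la setT).
  apply: le_trans (le_normr_Rintegral _ _) _ => //; first exact: cts_integrable.
  rewrite -Rintegral_cst//; apply: le_Rintegral => //; first exact: cts_integrable.
  by apply: cts_integrable => t; exact: cvg_cst.
apply: le_trans (ler_normB _ _) _; apply: le_trans (lerD (le_c _) (le_c _)) _.
rewrite -mulrDr mulrC /tv_norm /charge_abs/= /charge_variation/=.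
by rewrite fineD ?fin_num_measure.
Qed.

Let prod_cts n (x : 'I_n -> C) (D : pred 'I_n) :
  continuous (fun t => \prod_(i < n | D i) x i t).
Proof.
move=> t; apply: cvg_big => [|i _]; [exact: mul_continuous|exact: cts_fun].
Qed.

Lemma power_integral_oa n mu : (0 < n)%N ->
  (power_integral n mu : C -> R^o) \in @oa_polynomial R K n.
Proof.
move=> n0; apply/asboolP; split; last first.
  move=> x y xy; rewrite /power_integral.
  have cX (z : C) : continuous (fun t => z t ^+ n).
    move=> t; apply: (@continuous_comp _ _ _ z (fun r : R => r ^+ n)).
      exact: cts_fun.
    exact: exprn_continuous.
  have := charge_integralD mu 1 (cX x) (cX y); rewrite mul1r => <-.
  congr charge_integral; apply/funext => t.
  rewrite mul1r -[(x + y) t]/(x t + y t).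
  have /orP[/eqP ->|/eqP ->] : (x t == 0) || (y t == 0).
    have := xy t; rewrite /Num.min; case: ifP => _ /eqP; rewrite normr_eq0 => -> //.
    by rewrite orbT.
  - by rewrite expr0n gtn_eqF// !add0r.
  - by rewrite expr0n gtn_eqF// !addr0.
exists (fun x : 'I_n -> C => charge_integral mu (fun t => \prod_(i < n) x i t)).
split.
- move=> i x a y z.
  have cP (w : C) : continuous (fun t => w t * \prod_(j < n | j != i) x j t).
    by move=> t; apply: cvgM; [exact: cts_fun|exact: prod_cts].
  have prodE (w : C) : (fun t => \prod_(j < n) (dfwith x i w) j t) =
      (fun t => w t * \prod_(j < n | j != i) x j t).
    apply/funext => t; rewrite (bigD1 i)//= dfwithin; congr (_ * _).
    by apply: eq_bigr => j ji; rewrite dfwithout// eq_sym.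
  rewrite !prodE; have := charge_integralD mu a (cP y) (cP z); move=> <-.
  congr charge_integral; apply/funext => t.
  by rewrite -[(a *: y + z) t]/(a * y t + z t); ring.
- exists (tv_norm mu) => x; apply: charge_integral_le; first exact: prod_cts.
  by move=> t; rewrite normr_prod; apply: ler_prod => i _; rewrite normr_ge0/= C_norm_ub.
- move=> s x; congr charge_integral; apply/funext => t.
  by rewrite [RHS](reindex_inj (@perm_inj _ s)).
- move=> x; congr charge_integral; apply/funext => t.
  by rewrite prodr_const card_ord.
Qed.
Definition J n (n0 : (0 < n)%N) mu : @oa_poly R K n :=
  OAPoly (power_integral_oa mu n0).

End compact.
End representation.

(* Main.v *)
Require Import Defs.
From HB Require Import structures.
From mathcomp Require Import all_boot all_order all_algebra.
From mathcomp Require Import all_classical all_reals all_analysis.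
From mathcomp Require Import perm ring lra zify.

Set Implicit Arguments.
Unset Strict Implicit.
Unset Printing Implicit Defensive.

Import Order.TTheory GRing.Theory Num.Theory.
Import numFieldNormedType.Exports.

Local Open Scope classical_set_scope.
Local Open Scope ring_scope.

(** The map J : mu |-> (x |-> \int x ^ n dmu) is linear. What has to be
    shown is that it is onto, respects the order, and has the stated norms.

    J is onto. Let P(x) = A(x, ..., x) be orthogonally additive, A symmetric.
    Reading P(x + a y) = P(x) + a ^ n P(y), for disjoint x and y, as an identity of
    polynomials in a shows that A vanishes on every list that mixes copies of x with
    copies of y (additive_block_orthogonal). When an argument z of A is
    fixed, the form that remains has the same property: thresholding separates the
    supports of x and y, and a Urysohn function then splits z into a part disjoint
    from y and a part disjoint from x (block_orthogonal_cons). By induction A(x, y,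
    ...) = 0 for disjoint x and y and arbitrary other arguments
    (block_orthogonal_orthosymmetric). A bounded bilinear form b with b(x, y) = 0 for
    disjoint x, y satisfies b(f x, y) = b(x, f y) (orthosymmetric_balanced): on the
    pieces of a partition of unity by the values of a large multiple g of f, the
    function g is within a constant of an integer, and the error does not grow with
    the number of pieces because distant pieces are disjoint. Therefore A(x, ..., x)
    = L(x ^ n) with L(f) = A(f, 1, ..., 1), a bounded functional, and L is the integral
    against a regular signed measure (riesz_representation). The latter is proved by
    writing L as a difference of two functionals that are positive and additive on
    nonnegative functions, each of which gives an outer measure and, by the
    Caratheodory construction, a regular Borel measure.

    J respects the order and absolute values. By regularity, Urysohn functions
    approximate the indicator of the positive set of a Hahn decomposition of mu
    (positive_set_approx). So mu >= 0 as soon as \int f dmu >= 0 for all continuous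
    f >= 0, and all such f are n-th powers: J is an order isomorphism onto its
    image. The majorants of J mu and - J mu range over all homogeneous polynomials, not
    only the orthogonally additive ones; such a majorant has a form B, and splitting
    the first variable along a continuous near-sign of mu gives B >= the form of
    J |mu| (power_integral_abs). Hence | J mu | = J |mu|, and the regular norm of J mu
    is |mu|(K).

    The supremum norm of J mu is the supremum of | \int x ^ n dmu | over the unit ball.
    If n is odd the powers x ^ n fill the unit ball, and a near-sign of mu gives the
    total variation; if n is even they fill the functions with values in [0, 1], and the
    best choices are the near-indicators of the positive and the negative sets.

    Completeness of the measures comes from Riesz representation again: a Cauchy
    sequence converges as functionals, and the limit functional is a measure. The
    Banach lattice structure is then carried from measures to polynomials by J. *)

(** * Continuous functions: roots, Urysohn functions, the sup norm *)

Section continuity.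
Context {R : realType} {K : topologicalType}.
Implicit Types f g : K -> R.

Lemma cts_cst (c : R) : continuous (fun _ : K => c).
Proof. by move=> t; exact: cvg_cst. Qed.

Lemma ctsD f g : continuous f -> continuous g -> continuous (fun t => f t + g t).
Proof. by move=> cf cg t; apply: cvgD; [exact: cf|exact: cg]. Qed.

Lemma ctsN f : continuous f -> continuous (fun t => - f t).
Proof. by move=> cf t; apply: cvgN; exact: cf. Qed.

Lemma ctsM f g : continuous f -> continuous g -> continuous (fun t => f t * g t).
Proof. by move=> cf cg t; apply: cvgM; [exact: cf|exact: cg]. Qed.

Lemma cts_norm f : continuous f -> continuous (fun t => `|f t|).
Proof. by move=> cf t; apply: cvg_norm; exact: cf. Qed.

Lemma cts_max f g :
  continuous f -> continuous g -> continuous (fun t => Num.max (f t) (g t)).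
Proof. by move=> cf cg t; apply: continuous_max; [exact: cf|exact: cg]. Qed.

Lemma cts_min f g :
  continuous f -> continuous g -> continuous (fun t => Num.min (f t) (g t)).
Proof. by move=> cf cg t; apply: continuous_min; [exact: cf|exact: cg]. Qed.

Lemma ctsX n f : continuous f -> continuous (fun t => f t ^+ n).
Proof.
move=> cf; elim: n => [|n IHn]; first exact: cts_cst.
rewrite (_ : (fun t => _) = (fun t => f t * f t ^+ n)); first exact: ctsM.
by apply/funext => t; rewrite exprS.
Qed.

Lemma cts_sum I (r : seq I) (P : pred I) (F : I -> K -> R) :
  (forall i, continuous (F i)) -> continuous (fun t => \sum_(i <- r | P i) F i t).
Proof.
move=> cF; elim: r => [|i r IHr].
  by rewrite (_ : (fun t => _) = (fun=> 0)); [exact: cts_cst|apply/funext => t;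
    rewrite big_nil].
have [Pi|Pi] := boolP (P i).
  rewrite (_ : (fun t => _) = (fun t => F i t + \sum_(i <- r | P i) F i t));
    first exact: ctsD.
  by apply/funext => t; rewrite big_cons Pi.
rewrite (_ : (fun t => _) = (fun t => \sum_(i <- r | P i) F i t))//.
by apply/funext => t; rewrite big_cons (negbTE Pi).
Qed.

Lemma cts_prod I (r : seq I) (P : pred I) (F : I -> K -> R) :
  (forall i, continuous (F i)) -> continuous (fun t => \prod_(i <- r | P i) F i t).
Proof.
move=> cF; elim: r => [|i r IHr].
  by rewrite (_ : (fun t => _) = (fun=> 1)); [exact: cts_cst|apply/funext => t;
    rewrite big_nil].
have [Pi|Pi] := boolP (P i).
  rewrite (_ : (fun t => _) = (fun t => F i t * \prod_(i <- r | P i) F i t));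
    first exact: ctsM.
  by apply/funext => t; rewrite big_cons Pi.
rewrite (_ : (fun t => _) = (fun t => \prod_(i <- r | P i) F i t))//.
by apply/funext => t; rewrite big_cons (negbTE Pi).
Qed.

Definition nonneg_cts f := continuous f /\ forall t, 0 <= f t.

Lemma open_gt f (c : R) : continuous f -> open [set t | c < f t].
Proof.
move=> cf; have := @open_comp _ _ f [set r : R | c < r] => /(_ (fun t _ => cf t)).
by apply; exact: open_gt.
Qed.

Lemma closed_ge f (c : R) : continuous f -> closed [set t | c <= f t].
Proof.
move=> cf; rewrite (_ : [set _ | _] = ~` [set t | - c < - f t]).
  by apply: open_closedC; apply: open_gt; exact: ctsN.
by apply/seteqP; split => t /=; rewrite ltrN2 leNgt => /negP.
Qed.

End continuity.

Ltac cts :=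
  lazymatch goal with
  | |- continuous (fun=> ?c) => exact: cts_cst
  | |- continuous (fun t => @?f t + @?g t) => apply: ctsD; cts
  | |- continuous (fun t => - @?f t) => apply: ctsN; cts
  | |- continuous (fun t => @?f t * @?g t) => apply: ctsM; cts
  | |- continuous (fun t => @?f t ^+ _) => apply: ctsX; cts
  | |- continuous (fun t => `|@?f t|) => apply: cts_norm; cts
  | |- continuous (fun t => Num.max (@?f t) (@?g t)) => apply: cts_max; cts
  | |- continuous (fun t => Num.min (@?f t) (@?g t)) => apply: cts_min; cts
  | |- continuous (fun t => \sum_(i <- _ | @?P t i) @?F t i) => apply: cts_sum => ?; cts
  | |- continuous (fun t => \prod_(i <- _ | @?P t i) @?F t i) => apply: cts_prod => ?; cts
  | _ => first [ assumption | exact: cts_fun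
               | match goal with H : forall _, continuous _ |- _ => exact: H end | idtac ]
  end.

Section positive_negative_parts.
Context {R : realType} {K : topologicalType}.

Lemma cts_pos_neg (f : K -> R) : continuous f -> exists fp fn,
  [/\ nonneg_cts fp, nonneg_cts fn & f = (fun t => -1 * fn t + fp t)].
Proof.
move=> cf; exists (fun t => Num.max (f t) 0), (fun t => Num.max (- f t) 0); split.
- by split=> [|t]; [cts|rewrite le_max lexx orbT].
- by split=> [|t]; [cts|rewrite le_max lexx orbT].
- apply/funext => t; rewrite /Num.max.
  by case: ifPn; case: ifPn; rewrite -?leNgt; lra.
Qed.

End positive_negative_parts.

Section nth_root.
Context {R : realType}.

Definition root_pos (n : nat) (r : R) : R := Num.max r 0 `^ n%:R^-1.

Lemma root_pos_ge0 n r : 0 <= root_pos n r.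
Proof. exact: powR_ge0. Qed.

Lemma root_posK n r : (0 < n)%N -> 0 <= r -> root_pos n r ^+ n = r.
Proof.
move=> n0 r0; rewrite /root_pos max_l// -powR_mulrn ?powR_ge0// -powRrM.
by rewrite mulVf ?powRr1// pnatr_eq0 -lt0n.
Qed.

Lemma root_pos0 n r : (0 < n)%N -> r <= 0 -> root_pos n r = 0.
Proof. by move=> n0 r0; rewrite /root_pos max_r// powR0// invr_eq0 pnatr_eq0 -lt0n. Qed.

Let expr_superD n (u v : R) : (0 < n)%N -> 0 <= u -> 0 <= v ->
  u ^+ n + v ^+ n <= (u + v) ^+ n.
Proof.
move=> n0 u0 v0; elim: n n0 => // -[|n] IHn _; first by rewrite !expr1.
rewrite !(exprS _ n.+1); apply: le_trans (ler_wpM2l (addr_ge0 u0 v0) (IHn isT)).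
have := mulr_ge0 u0 (exprn_ge0 n.+1 v0); have := mulr_ge0 v0 (exprn_ge0 n.+1 u0).
by rewrite mulrDl !mulrDr; lra.
Qed.

(** Superadditivity of the n-th power, u ^ n + v ^ n <= (u + v) ^ n, bounds the
    oscillation of the root: a jump of size e costs e ^ n in the argument. *)
Lemma root_pos_continuous n : (0 < n)%N -> continuous (root_pos n).
Proof.
move=> n0 r; apply/cvgrPdist_lt => e e0.
have en0 : 0 < e ^+ n by rewrite exprn_gt0.
have step (a b : R) : a <= b -> b - a < e ^+ n -> root_pos n b - root_pos n a < e.
  move=> ab lt_e; rewrite ltNge; apply/negP => le_e.
  have : root_pos n b ^+ n <= root_pos n a ^+ n + (b - a).
    have maxD x : root_pos n x ^+ n = Num.max x 0.
      have [x0|x0] := leP 0 x; first by rewrite root_posK// max_l.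
      by rewrite root_pos0 ?(ltW x0)// expr0n gtn_eqF//.
    by rewrite !maxD; case: (leP a 0); case: (leP b 0); lra.
  have /le_trans h := @expr_superD n (root_pos n a) e n0 (root_pos_ge0 _ _) (ltW e0).
  move=> /(le_trans (h _ _)); rewrite lerD2l => h2.
  have : e ^+ n <= b - a.
    by apply: h2; rewrite ler_pXn2r ?nnegrE ?addr_ge0 ?root_pos_ge0 ?(ltW e0)// -lerBrDl.
  by rewrite leNgt lt_e.
near=> s; have rs : `|r - s| < e ^+ n by near: s; exact: (@cvgr_dist_lt _ _ _ (nbhs r) _
  id).
have rootW a b : a <= b -> root_pos n a <= root_pos n b.
  move=> ab; have m0 (x : R) : Num.max x 0 \is Num.nneg by rewrite nnegrE le_max lexx orbT.
  apply: ge0_ler_powR => //.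
  by rewrite ge_max !le_max ab lexx orbT.
have [le_sr|/ltW le_rs] := leP s r.
  by rewrite ger0_norm ?subr_ge0 ?rootW//; apply: step => //; apply: le_lt_trans rs;
    exact: ler_norm.
rewrite distrC ger0_norm ?subr_ge0 ?rootW//; apply: step => //.
by apply: le_lt_trans rs; rewrite distrC; exact: ler_norm.
Unshelve. all: by end_near. Qed.

Lemma cts_root (K : topologicalType) n (f : K -> R) : (0 < n)%N ->
  continuous f -> continuous (fun t => root_pos n (f t)).
Proof.
move=> n0 cf t; apply: (@continuous_comp _ _ _ f (root_pos n)); first exact: cf.
exact: root_pos_continuous.
Qed.

End nth_root.

Section compact_hausdorff.
Context {R : realType} {K : ptopologicalType}.
Hypothesis cK : compact [set: K].

Lemma urysohn (hK : hausdorff_space K) (A B : set K) : closed A -> closed B ->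
  A `&` B = set0 -> exists f : K -> R, [/\ continuous f,
    forall t, 0 <= f t <= 1, forall t, A t -> f t = 0 & forall t, B t -> f t = 1].
Proof.
move=> cA cB AB.
have [f [cf fA fB f01]] := urysohn_ext_itv (compact_normal hK cK) cA cB AB (@ltr01 R).
exists f; split => // t.
- by have := f01 (f t); rewrite /= in_itv/=; apply; exists t.
- by move=> At; apply: fA; exists t.
- by move=> Bt; apply: fB; exists t.
Qed.

Lemma cts_bounded (f : K -> R) : continuous f -> exists c, forall t, `|f t| <= c.
Proof.
move=> cf; have /compact_bounded[M [_ fM]] : compact (f @` [set: K]).
  by apply: continuous_compact => //; exact: continuous_subspaceT.
exists (M + 1) => t; apply: (fM (M + 1)); first by rewrite ltrDl.
by exists t.
Qed.

Lemma C_norm_ub (x : continuousType K R) t : `|x t| <= C_norm x.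
Proof.
have [c xc] := cts_bounded (@cts_fun _ _ x).
by apply: ub_le_sup; [exists c => _ [s _ <-]; exact: xc|exists t].
Qed.

Lemma C_norm_ge0 (x : continuousType K R) : 0 <= C_norm x.
Proof. exact: le_trans (normr_ge0 (x point)) (C_norm_ub x point). Qed.

Lemma C_norm_le (x : continuousType K R) c : (forall t, `|x t| <= c) -> C_norm x <= c.
Proof. by move=> xc; apply: ge_sup; [exists `|x point|, point|move=> _ [t _ <-]]. Qed.

(** The element of C(K) given by a function; off the continuous functions the
    value is junk, which keeps proofs of continuity out of the terms. *)
Definition C_of (f : K -> R) : continuousType K R :=
  if pselect (continuous f) is left cf then mkcts cf else 0.

Lemma C_ofE f : continuous f -> C_of f = f :> (K -> R).
Proof. by rewrite /C_of; case: pselect. Qed.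

Lemma C_ofK (x : continuousType K R) : C_of x = x.
Proof. by apply/continuousEP => t; rewrite C_ofE//; exact: cts_fun. Qed.

Lemma C_ofD (a : R) f g : continuous f -> continuous g ->
  C_of (fun t => a * f t + g t) = a *: C_of f + C_of g.
Proof.
move=> cf cg; apply/continuousEP => t; rewrite C_ofE; last by cts.
by rewrite -[RHS]/(a * C_of f t + C_of g t) !C_ofE.
Qed.

End compact_hausdorff.

(** * Integrals of continuous functions against finite Borel measures *)

Section borel_integral.
Context {R : realType} {K : ptopologicalType}.
Hypothesis cK : compact [set: K].
Implicit Types (la : {finite_measure set (borel K) -> \bar R}) (f g : K -> R).

Lemma cts_measurable f : continuous f -> measurable_fun [set: borel K] (f : borel K -> R).
Proof.
move=> cf; apply: (measurability _ (measurable_realfun.RGenOpens.measurableE R)) =>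
  _ [_ [a [b ->]] <-].
rewrite setTI; apply: open_borel; apply: open_comp; last exact: interval_open.
by move=> t _; exact: cf.
Qed.

Lemma cts_integrable la f : continuous f -> la.-integrable [set: borel K] (EFin \o f).
Proof.
move=> cf; apply: measurable_bounded_integrable => //.
- by rewrite ltey_eq fin_num_measure.
- exact: cts_measurable.
- have [c fc] := cts_bounded cK cf; exists c; split; first exact: num_real.
  by move=> M cM t _; exact: le_trans (fc t) (ltW cM).
Qed.

Lemma RintD la f g : continuous f -> continuous g ->
  \int[la]_t (f t + g t) = \int[la]_t f t + \int[la]_t g t.
Proof. by move=> cf cg; rewrite RintegralD//; exact: cts_integrable. Qed.

Lemma RintZ la a f : continuous f -> \int[la]_t (a * f t) = a * \int[la]_t f t.
Proof. by move=> cf; rewrite RintegralZl//; exact: cts_integrable. Qed.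

Lemma Rint_cst la (c : R) : \int[la]_t (c : R) = c * fine (la setT).
Proof. by rewrite Rintegral_cst. Qed.

Lemma Rint_le la f g : continuous f -> continuous g -> (forall t, f t <= g t) ->
  \int[la]_t f t <= \int[la]_t g t.
Proof. by move=> cf cg fg; apply: le_Rintegral => //; exact: cts_integrable. Qed.

Lemma Rint_ge0 la f : (forall t, 0 <= f t) -> 0 <= \int[la]_t f t.
Proof. by move=> f0; apply: Rintegral_ge0. Qed.

Lemma Rint_cstB la (c : R) f : continuous f ->
  \int[la]_t (c - f t) = c * fine (la setT) - \int[la]_t f t.
Proof.
move=> cf; have cc := @cts_cst R K c; have cmf : continuous (fun t => -1 * f t) by cts.
rewrite -Rint_cst -mulN1r -RintZ// -RintD//.
by apply: eq_Rintegral => t _; rewrite mulN1r.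
Qed.

Lemma Rint_indic la (A : set (borel K)) : measurable A -> \int[la]_t \1_A t = fine (la A).
Proof. by move=> mA; rewrite /Rintegral integral_indic// setIT. Qed.

Lemma measure_le_Rint la f (A : set (borel K)) : continuous f -> measurable A ->
  (forall t, 0 <= f t) -> (forall t, A t -> 1 <= f t) -> fine (la A) <= \int[la]_t f t.
Proof.
move=> cf mA f0 f1; rewrite -Rint_indic//; apply: le_Rintegral => //.
- exact: integrable_indic.
- exact: cts_integrable.
- move=> t _; rewrite indicE; case: (boolP (t \in A)) => [|_]; last exact: f0.
  by rewrite inE => /f1.
Qed.

Lemma Rint_le_measure la f (A : set (borel K)) : continuous f -> measurable A ->
  (forall t, f t <= 1) -> (forall t, ~ A t -> f t <= 0) -> \int[la]_t f t <= fine (la A).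
Proof.
move=> cf mA f0 f1; rewrite -Rint_indic//; apply: le_Rintegral => //.
- exact: cts_integrable.
- exact: integrable_indic.
- move=> t _; rewrite indicE; case: (boolP (t \in A)) => [_|]; first exact: f0.
  by rewrite notin_setE => /f1.
Qed.

End borel_integral.

(** * The measure of a positive functional *)

Section outer_measure_of_functional.
Context {R : realType} {K : ptopologicalType}.
Hypotheses (cK : compact [set: K]) (hK : hausdorff_space K).
Variable p : (K -> R) -> R.
Implicit Types (a c e : R) (f g y z : K -> R).

Hypothesis p_ge0 : forall f, nonneg_cts f -> 0 <= p f.
Hypothesis pD : forall f g, nonneg_cts f -> nonneg_cts g ->
  p (fun t => f t + g t) = p f + p g.
Hypothesis pZ : forall a f, 0 <= a -> nonneg_cts f -> p (fun t => a * f t) = a * p f.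

Definition under (U : set K) (f : K -> R) :=
  [/\ continuous f, forall t, 0 <= f t <= 1 & forall t, ~ U t -> f t = 0].

Definition open_content (U : set K) : R := sup [set p f | f in under U].

(** Outer regularity of the measure to be constructed holds by this definition. *)
Definition outer_content (E : set K) : R :=
  inf [set open_content U | U in [set U | open U /\ E `<=` U]].

Let underW U f : under U f -> nonneg_cts f.
Proof. by case=> cf f01 _; split => // t; have /andP[] := f01 t. Qed.

Let ncst (c : R) : 0 <= c -> nonneg_cts (fun _ : K => c).
Proof. by move=> c0; split => //; exact: cts_cst. Qed.

Let under0 U : under U (fun=> 0).
Proof. by split => // [|t]; [exact: cts_cst|rewrite lexx ler01]. Qed.

Let p_mono f g : nonneg_cts f -> continuous g -> (forall t, f t <= g t) -> p f <= p g.
Proof.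
move=> [cf f0] cg fg.
have nh : nonneg_cts (fun t => g t - f t).
  by split => [|t]; [cts|rewrite subr_ge0].
have -> : g = (fun t => f t + (g t - f t)) by apply/funext => t; rewrite subrKC.
by rewrite pD// lerDl p_ge0.
Qed.

Let p_cst c : 0 <= c -> p (fun=> c) = c * p (fun=> 1).
Proof.
move=> c0; rewrite -pZ//; last exact: ncst.
by congr p; apply/funext => t; rewrite mulr1.
Qed.

Let p1_ge0 : 0 <= p (fun=> 1).
Proof. by apply: p_ge0; exact: ncst. Qed.

Let under_has_sup U : has_sup [set p f | f in under U].
Proof.
split; first by exists (p (fun=> 0)), (fun=> 0).
exists (p (fun=> 1)) => _ [f uf <-]; apply: p_mono; first exact: underW uf.
  exact: cts_cst.
by move=> t; case: uf => _ /(_ t)/andP[].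
Qed.

Let p_le_content U f : under U f -> p f <= open_content U.
Proof. by move=> uf; apply: ub_le_sup; [case: (under_has_sup U)|exists f]. Qed.

Let content_le U c : (forall f, under U f -> p f <= c) -> open_content U <= c.
Proof.
move=> le_c; apply: ge_sup; first by case: (under_has_sup U).
by move=> _ [f uf <-]; exact: le_c.
Qed.

Let content_ge0 U : 0 <= open_content U.
Proof. by apply: le_trans (p_le_content (under0 U)); apply: p_ge0; exact: ncst. Qed.

Let content_mono U V : U `<=` V -> open_content U <= open_content V.
Proof.
move=> UV; apply: content_le => f [cf f01 f0]; apply: p_le_content; split => // t nVt.
by apply: f0 => /UV.
Qed.

Let content0 : open_content set0 = 0.
Proof.
apply/eqP; rewrite eq_le content_ge0 andbT; apply: content_le => f [_ _ f0].
have -> : f = (fun=> 0) by apply/funext => t; exact: f0.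
by rewrite p_cst// mul0r.
Qed.

(** Lowering f by e makes it vanish off the closed set [e <= f] at a cost
    of at most e * p 1: this replaces compactly supported functions. *)
Let lower e (f : K -> R) : K -> R := fun t => Num.max (f t - e) 0.

Let under_lower U e f : 0 <= e -> under U f -> under U (lower e f).
Proof.
move=> e0 [cf f01 f0]; split => [|t|t nUt]; rewrite /lower.
- by cts.
- by have /andP[f_ge0 f_le1] := f01 t; rewrite le_max lexx orbT ge_max ler01 andbT/=; lra.
- by rewrite f0// sub0r; apply: max_r; rewrite oppr_le0.
Qed.

Let p_lower U e f : 0 <= e -> under U f -> p f <= p (lower e f) + e * p (fun=> 1).
Proof.
move=> e0 uf; rewrite -p_cst// -pD; [|exact: underW (under_lower _ uf)|exact: ncst].
have [cf _ _] := uf; apply: p_mono; first exact: underW uf.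
  by rewrite /lower; cts.
by move=> t; rewrite /lower -lerBlDr le_max lexx.
Qed.

Let p_le_approx f c : nonneg_cts f ->
  (forall e, 0 < e -> p f <= c + e * p (fun=> 1)) -> p f <= c.
Proof.
move=> nf h; apply/ler_addgt0Pr => e e0.
have p1 : 0 < p (fun=> 1) + 1 by rewrite ltr_wpDl.
apply: le_trans (h (e / (p (fun=> 1) + 1)) _) _; first by rewrite divr_gt0.
rewrite lerD2l mulrAC ler_pdivrMr// ler_pM2l// lerDl//.
Qed.

Let contentU U V : open U -> open V ->
  open_content (U `|` V) <= open_content U + open_content V.
Proof.
move=> oU oV; apply: content_le => f uf; apply: p_le_approx; first exact: underW uf.
move=> e e0; apply: le_trans (p_lower (ltW e0) uf) _; rewrite lerD2r.
have [cf f01 f0] := uf; pose S := [set t | e <= f t].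
(* u is 1 on the part of S that V misses, and lives in U. *)
have [u [cu u01 u0 u1]] : exists u : K -> R, [/\ continuous u,
    forall t, 0 <= u t <= 1, forall t, (~` U) t -> u t = 0 &
    forall t, (S `\` V) t -> u t = 1].
  apply: urysohn => //; first exact: open_closedC.
    by apply: closedI; [exact: closed_ge|exact: open_closedC].
  apply/seteqP; split => // t [/= nUt [St nVt]].
  by move: St; rewrite /S/= f0 ?leNgt ?e0// => -[].
have [cl l01 l0] := under_lower (ltW e0) uf.
have uU : under U (fun t => lower e f t * u t).
  split => [|t|t nUt]; [by cts| |by rewrite u0 ?mulr0].
  by have /andP[? ?] := l01 t; have /andP[? ?] := u01 t; rewrite mulr_ge0//= mulr_ile1.
have uV : under V (fun t => lower e f t * (1 - u t)).
  split => [|t|t nVt]; first by cts.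
    have /andP[? ?] := l01 t; have /andP[? ?] := u01 t.
    by rewrite mulr_ge0 ?subr_ge0//= mulr_ile1 ?subr_ge0//; lra.
  have [St|/negP nSt] := boolP (e <= f t).
    by rewrite (u1 t) ?subrr ?mulr0//; split.
  by rewrite /lower max_r ?mul0r//; move/negP: nSt; rewrite -ltNge => /ltW; lra.
apply: le_trans (lerD (p_le_content uU) (p_le_content uV)).
rewrite -pD; [|exact: underW uU|exact: underW uV].
by rewrite le_eqVlt; apply/orP; left; apply/eqP; congr p; apply/funext => t; ring.
Qed.

Let content_bigU (F : (set K)^nat) n : (forall i, open (F i)) ->
  open_content (\big[setU/set0]_(i < n) F i) <= \sum_(i < n) open_content (F i).
Proof.
move=> oF; elim: n => [|n IHn]; first by rewrite !big_ord0 content0.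
rewrite !big_ord_recr/=; apply: le_trans (contentU _ (oF n)) _; last by rewrite lerD2r.
by rewrite -bigcup_mkord; apply: bigcup_open => i _; exact: oF.
Qed.

Let content_bigcup (F : (set K)^nat) : (forall i, open (F i)) ->
  ((open_content (\bigcup_i F i))%:E <= \sum_(i <oo) (open_content (F i))%:E)%E.
Proof.
move=> oF; have F0 i : (0 <= (open_content (F i))%:E)%E by rewrite lee_fin.
have := @nneseries_ge0 _ (fun i => (open_content (F i))%:E) xpredT 0%N (fun i _ _ => F0 i).
case sE : (\sum_(i <oo) _)%E => [s||] // _; last by rewrite leey.
rewrite lee_fin; apply: content_le => f uf; apply: p_le_approx; first exact: underW uf.
move=> e e0; apply: le_trans (p_lower (ltW e0) uf) _; rewrite lerD2r.
have [cf f01 f0] := uf.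
have cS : compact [set t | e <= f t].
  by apply: (subclosed_compact _ cK) => //; exact: closed_ge.
move: cS; rewrite compact_cover => /(_ _ setT F).
case=> [i _|t /= et|D _ SD]; first exact: oF.
  apply: contrapT => nt; move: et; rewrite f0 ?leNgt ?e0//.
pose N := (\max_(i <- finmap.enum_fset D) i).+1.
have uF : under (\big[setU/set0]_(i < N) F i) (lower e f).
  have [cl l01 _] := under_lower (ltW e0) uf; split => // t nt.
  rewrite /lower max_r// subr_le0; apply: ltW; rewrite ltNge; apply/negP => et.
  have [i iD Fit] := SD t et; apply: nt; rewrite -bigcup_mkord; exists i => //=.
  by rewrite ltnS; apply: leq_bigmax_seq.
apply: le_trans (p_le_content uF) _; apply: le_trans (content_bigU _ oF) _.
by rewrite -lee_fin -sE -sumEFin -(big_mkord xpredT (fun i => (open_content (F i))%:E));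
  exact: nneseries_lim_ge.
Qed.

Let outer_has_inf E :
  has_inf [set open_content U | U in [set U | open U /\ E `<=` U]].
Proof.
split; first by exists (open_content setT), setT => //; split => //; exact: openT.
by exists 0 => _ [U _ <-].
Qed.

Let outer_open_le E U : open U -> E `<=` U -> outer_content E <= open_content U.
Proof. by move=> oU EU; apply: ge_inf; [case: (outer_has_inf E)|exists U]. Qed.

Let outer_ge E c : (forall U, open U -> E `<=` U -> c <= open_content U) ->
  c <= outer_content E.
Proof.
move=> le_c; apply: lb_le_inf; first by case: (outer_has_inf E).
by move=> _ [U [oU EU] <-]; exact: le_c.
Qed.

Let outer_approx E e : 0 < e ->
  exists U, [/\ open U, E `<=` U & open_content U < outer_content E + e].
Proof.
move=> e0; have [_ [U [oU EU] <-] lt_e] := inf_adherent e0 (outer_has_inf E).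
by exists U.
Qed.

Let outer_open U : open U -> outer_content U = open_content U.
Proof.
move=> oU; apply/eqP; rewrite eq_le outer_open_le//=.
by apply: outer_ge => V _; exact: content_mono.
Qed.

Definition outer (E : set K) : \bar R := (outer_content E)%:E.

Let outer0 : outer set0 = 0%E.
Proof. by rewrite /outer outer_open ?content0//; exact: open0. Qed.

Let outer_ge0 E : (0 <= outer E)%E.
Proof. by rewrite lee_fin; apply: outer_ge. Qed.

Let le_outer : {homo outer : A B / A `<=` B >-> (A <= B)%E}.
Proof.
move=> A B AB; rewrite lee_fin; apply: outer_ge => U oU BU; apply: outer_open_le => //.
exact: subset_trans BU.
Qed.

Let outer_sigma : sigma_subadditive outer.
Proof.
move=> F; apply/lee_addgt0Pr => e e0.
apply: (@le_trans _ _ (\sum_(i <oo) (outer (F i) + (e / (2 ^ i.+1)%:R)%:E))%E); last first.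
  by apply: epsilon_trick => //; exact: ltW.
have /choice[U UP] : forall i, exists U, [/\ open U, F i `<=` U &
    open_content U < outer_content (F i) + e / (2 ^ i.+1)%:R].
  by move=> i; apply: outer_approx; rewrite divr_gt0// ltr0n expn_gt0.
apply: (@le_trans _ _ (\sum_(i <oo) (open_content (U i))%:E)%E); last first.
  apply: lee_nneseries => [i _ _|i _]; first by rewrite lee_fin.
  by have [_ _ /ltW] := UP i; rewrite /outer -EFinD lee_fin.
apply: le_trans (content_bigcup _); last by move=> i; have [] := UP i.
rewrite lee_fin; apply: outer_open_le.
  by apply: bigcup_open => i _; have [] := UP i.
by move=> t [i _ Fit]; exists i => //; have [_ + _] := UP i; apply.
Qed.

HB.instance Definition _ :=
  isOuterMeasure.Build R K outer outer0 outer_ge0 le_outer outer_sigma.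

(** If f is under the intersection of V and U, and S = [e <= f],
  then the lowered f and a function
    under V minus S have disjoint supports, so their sum stays under V. *)
Let caratheodory_open U : open U -> caratheodory_measurable outer U.
Proof.
move=> oU; apply: le_caratheodory_measurable => E.
rewrite /outer -EFinD lee_fin; apply: outer_ge => V oV EV.
have oVU : open (V `&` U) by exact: openI.
rewrite -lerBrDr; apply: le_trans (outer_open_le oVU _) _.
  by move=> t [/EV].
apply: content_le => f uf; apply: p_le_approx; first exact: underW uf.
move=> e e0; apply: le_trans (p_lower (ltW e0) uf) _; rewrite lerD2r.
have [cf f01 f0] := uf; have [cl l01 l0] := under_lower (ltW e0) uf.
pose W := V `\` [set t | e <= f t].
have oW : open W by apply: openI => //; apply: closed_openC; exact: closed_ge.
rewrite lerBrDl -lerBrDr; apply: le_trans (outer_open_le oW _) _.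
  move=> t [Et nUt]; split; first exact: EV.
  by rewrite /= f0; [rewrite leNgt e0|move=> []].
apply: content_le => g ug; have [cg g01 g0] := ug; rewrite lerBrDr -pD.
- apply: p_le_content; split => [|t|t nVt]; first by cts.
    have [St|nSt] := boolP (e <= f t); first by rewrite (g0 t) ?add0r// => -[].
    have -> : lower e f t = 0.
      by rewrite /lower max_r//; move: nSt; rewrite -ltNge => /ltW; lra.
    by rewrite addr0.
  by rewrite l0 ?addr0 ?g0//; move=> [].
- exact: underW ug.
- exact: underW (under_lower (ltW e0) uf).
Qed.

Let borel_caratheodory (A : set (borel K)) :
  measurable A -> caratheodory_measurable outer A.
Proof.
apply: (@smallest_sub _ _ _ (measurable : set (set (caratheodory_type outer)))).
  exact: sigma_algebra_measurable.
by move=> U; exact: caratheodory_open.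
Qed.

Let borel_outer : set (borel K) -> \bar R := outer.

Let borel_outer_sigma : semi_sigma_additive borel_outer.
Proof.
move=> F mF tF mUF; apply: (@caratheodory_measure_sigma_additive _ _ outer) => //.
  by move=> i; exact: borel_caratheodory.
exact: borel_caratheodory.
Qed.

HB.instance Definition _ := isMeasure.Build _ (borel K) R borel_outer
  outer0 outer_ge0 borel_outer_sigma.

Let borel_outer_fin : fin_num_fun borel_outer.
Proof. by []. Qed.

HB.instance Definition _ := Measure_isFinite.Build _ (borel K) R borel_outer
  borel_outer_fin.

Let borel_measure : {finite_measure set (borel K) -> \bar R} := borel_outer.

Let p_under U f : open U -> under U f -> p f <= fine (borel_measure U).
Proof. by move=> oU uf; apply: le_trans (p_le_content uf) _; rewrite -outer_open. Qed.

(** Slicing y at the integers: the slice of y between M and M + 1 lies under the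
    open set [M < y], whose indicator lies below the same slice of y + 1. *)
Let p_le_slices y (M : nat) : nonneg_cts y ->
  p (fun t => Num.min (y t) M%:R) <= \int[borel_measure]_t Num.min (y t + 1) M%:R.
Proof.
move=> [cy y0].
pose sl (z : K -> R) k t : R := Num.min (Num.max (z t - k%:R) 0) 1.
have slE z k : (forall t, 0 <= z t) ->
    (fun t => Num.min (z t) k.+1%:R) = (fun t => Num.min (z t) k%:R + sl z k t).
  move=> z0; apply/funext => t; rewrite /sl -natr1; have := ler0n R k; have := z0 t.
  rewrite /Num.min /Num.max.
  by case: ifPn; case: ifPn; do ?case: ifPn; rewrite -?leNgt; lra.
pose y1 t : R := y t + 1.
have y10 t : 0 <= y1 t by rewrite addr_ge0.
have nmin z k : nonneg_cts z -> nonneg_cts (fun t => Num.min (z t) k%:R).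
  by move=> [cz z0]; split => [|t]; [cts|rewrite le_min z0/=].
have nsl z k : nonneg_cts z -> nonneg_cts (sl z k).
  move=> [cz z0]; rewrite /sl; split => [|t]; first by cts.
  by rewrite le_min le_max lexx orbT ler01.
have ny1 : nonneg_cts y1 by split => //; rewrite /y1; cts.
elim: M => [|M IHM].
  have -> : (fun t => Num.min (y t) 0%:R) = (fun=> 0).
    by apply/funext => t; rewrite min_r.
  by rewrite p_cst// mul0r; apply: Rint_ge0 => t; rewrite le_min y10/=.
rewrite (slE y)// pD; [|exact: nmin|exact: nsl].
rewrite [X in _ <= X](_ : _ = \int[borel_measure]_t (Num.min (y1 t) M%:R + sl y1 M t));
  last first.
  by rewrite -(slE y1).
rewrite RintD//; [|by case: (nmin _ M ny1)|by case: (nsl _ M ny1)].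
apply: lerD => //; pose U := [set t | M%:R < y t].
have oU : open U by exact: open_gt.
apply: (@le_trans _ _ (fine (borel_measure U))).
  apply: p_under => //; have [cs s0] := nsl y M (conj cy y0); split => // t.
    by rewrite s0/= /sl ge_min lexx orbT.
  move=> /negP; rewrite -leNgt => yM; rewrite /sl max_r ?subr_le0//.
  by rewrite min_l.
have [cs s0] := nsl _ M ny1; apply: measure_le_Rint => //; first exact: open_borel.
by move=> t; rewrite /U/= /sl /y1 => yM; rewrite le_min lexx andbT le_max; apply/orP;
  left; lra.
Qed.

Let total : fine (borel_measure setT) = p (fun=> 1).
Proof.
rewrite /= outer_open; last exact: openT.
apply/eqP; rewrite eq_le p_le_content ?andbT; last first.
  by split => [|t|t /(_ I)//]; [exact: cts_cst|rewrite ler01 lexx].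
apply: content_le => f [cf f01 f0]; apply: p_mono; [|exact: cts_cst|by move=> t;
  case/andP: (f01 t)].
by split => // t; case/andP: (f01 t).
Qed.

Let p_le_Rint f : nonneg_cts f -> p f <= \int[borel_measure]_t f t.
Proof.
move=> nf; have [cf f0] := nf; apply: p_le_approx => // e e0.
have [c fc] := cts_bounded cK cf.
have c0 : 0 <= c by exact: le_trans (fc point).
pose N := (Num.truncn e^-1).+1.
have N0 : 0 < N%:R :> R by rewrite ltr0n.
have eN : 1 <= e * N%:R.
  rewrite mulrC -ler_pdivrMr// mul1r ltW// /N; exact: truncnS_gt.
have nNf : nonneg_cts (fun t => N%:R * f t) by split => [|t]; [cts|rewrite mulr_ge0].
pose M := (Num.truncn (N%:R * c + 1)).+1.
have fM t : N%:R * f t + 1 <= M%:R.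
  apply: le_trans (ltW (truncnS_gt _)); rewrite lerD2r ler_pM2l//.
  exact: le_trans (ler_norm _) (fc t).
have := p_le_slices M nNf.
rewrite (_ : (fun t => Num.min _ _) = (fun t => N%:R * f t)); last first.
  by apply/funext => t; rewrite min_l//; apply: le_trans (fM t); rewrite lerDl.
under eq_Rintegral do rewrite (min_l (fM _)).
have cst1 := @cts_cst R K 1.
rewrite pZ// RintD ?RintZ ?Rint_cst//; last by cts.
rewrite total => leN; have /(ler_wpM2r p1_ge0) eNp := eN.
rewrite -(ler_pM2l N0) mulrDr; lra.
Qed.

(** Slicing gives p f <= \int f only; applied to c - f for a constant c >= f, it
    gives the converse, because both sides agree on constants. *)
Lemma positive_functional_measure :
  exists m : {finite_measure set (borel K) -> \bar R},
    (forall f, nonneg_cts f -> p f = \int[m]_t f t) /\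
    (forall (A : set K) e, 0 < e ->
      exists U : set K, [/\ open U, A `<=` U & (m U < m A + e%:E)%E]).
Proof.
exists borel_measure; split => [f nf|A e e0]; last first.
  have [U [oU AU lt_e]] := outer_approx A e0; exists U; split => //.
  by rewrite /= /outer -EFinD lte_fin outer_open.
have [cf f0] := nf; apply/eqP; rewrite eq_le p_le_Rint//=.
have [c fc] := cts_bounded cK cf.
have c0 : 0 <= c by exact: le_trans (fc point).
have nc : nonneg_cts (fun t => c - f t).
  split => [|t]; first by cts.
  by rewrite subr_ge0; apply: le_trans (ler_norm _) (fc t).
have := p_le_Rint nc.
rewrite Rint_cstB// total.
have : p (fun=> c) = p f + p (fun t => c - f t).
  by rewrite -pD//; congr p; apply/funext => t; rewrite addrC subrK.
rewrite p_cst//; lra.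
Qed.

End outer_measure_of_functional.

(** * Charges and the Riesz representation theorem *)

Section charges.
Context {R : realType} {K : ptopologicalType}.
Hypotheses (cK : compact [set: K]).
Implicit Types (mu nu : {charge set (borel K) -> \bar R}) (f : K -> R).
Implicit Types (A : set (borel K)).

Lemma charge_jordan mu A : measurable A -> mu A = (charge_pos mu A - charge_neg mu A)%E.
Proof. by move=> mA; rewrite {1}(jordan_decomp (svalP (hahn mu)) mA) /cadd/= cscaleN1. Qed.

Lemma charge_posE mu A : measurable A -> charge_pos mu A = mu (A `&` (sval (hahn mu)).1).
Proof. by move=> mA; rewrite /charge_pos/= jordan_posE cjordan_posE /crestr0 mem_set. Qed.

Lemma charge_negE mu A : measurable A -> charge_neg mu A =
  (- mu (A `&` (sval (hahn mu)).2))%E.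
Proof. by move=> mA; rewrite /charge_neg/= jordan_negE cjordan_negE /crestr0 mem_set. Qed.

Lemma charge_absE mu A : charge_abs mu A = (charge_pos mu A + charge_neg mu A)%E.
Proof. by []. Qed.

Lemma charge_abs_nonneg mu : (forall A, measurable A -> (0 <= mu A)%E) ->
  forall A, measurable A -> charge_abs mu A = mu A.
Proof.
move=> mu0 A mA; apply/eqP; rewrite eq_le; apply/andP; split.
  have [mP mN] : measurable (sval (hahn mu)).1 /\ measurable (sval (hahn mu)).2.
    by have [[mP _] [mN _] _ _] := svalP (hahn mu); split.
  rewrite charge_absE charge_posE// charge_negE//.
  have [_ _ PN PN0] := svalP (hahn mu).
  rewrite -[X in (_ <= mu X)%E](setIT A) -PN setIUr chargeU;
    [|exact: measurableI|exact: measurableI|by rewrite setIACA PN0 setI0].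
  rewrite leeD2l//; have := mu0 _ (measurableI _ _ mA mN).
  move=> h; apply: le_trans h; rewrite leeNl oppe0; exact: mu0 (measurableI _ _ mA mN).
by apply: le_trans (lee_abs _) (abse_charge_variation _ mA).
Qed.

Lemma Rint_measure_add (m1 m2 : {finite_measure set (borel K) -> \bar R})
    (m : {measure set (borel K) -> \bar R}) f : continuous f ->
  (forall A, measurable A -> m A = (m1 A + m2 A)%E) ->
  \int[m]_t f t = \int[m1]_t f t + \int[m2]_t f t.
Proof.
move=> cf mE; rewrite /Rintegral -fineD; last 2 first.
- by apply: integrable_fin_num => //; exact: cts_integrable.
- by apply: integrable_fin_num => //; exact: cts_integrable.
rewrite -integral_measure_add//; [|exact: cts_integrable|exact: cts_integrable].
by congr fine; apply: eq_measure_integral => A mA _; rewrite mE// -measure_addE.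
Qed.

(** The integral against a charge does not see which decomposition into a
    difference of positive measures it is computed from. *)
Lemma charge_integralE mu (m1 m2 : {finite_measure set (borel K) -> \bar R}) f :
  continuous f -> (forall A, measurable A -> mu A = (m1 A - m2 A)%E) ->
  charge_integral mu f = \int[m1]_t f t - \int[m2]_t f t.
Proof.
move=> cf muE; rewrite /charge_integral.
suff : \int[charge_pos mu]_t f t + \int[m2]_t f t =
       \int[m1]_t f t + \int[charge_neg mu]_t f t by lra.
rewrite -(@Rint_measure_add (charge_pos mu) m2 (measure_add (charge_pos mu) m2))//;
  last first.
  by move=> A mA; exact: measure_addE.
apply: Rint_measure_add => // A mA; apply: eq_trans (measure_addE _ _ _) _.
suff : (charge_pos mu A + m2 A = m1 A + charge_neg mu A)%E by [].
have fp : charge_pos mu A \is a fin_num by exact: fin_num_measure.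
have fn : charge_neg mu A \is a fin_num by exact: fin_num_measure.
have f1 : m1 A \is a fin_num by exact: fin_num_measure.
have f2 : m2 A \is a fin_num by exact: fin_num_measure.
have := muE A mA; rewrite (charge_jordan mu mA).
rewrite -(fineK fp) -(fineK fn) -(fineK f1) -(fineK f2) -!EFinB -!EFinD => -[eqA].
by congr (_%:E); lra.
Qed.

Lemma charge_integralD mu (a : R) f g : continuous f -> continuous g ->
  charge_integral mu (fun t => a * f t + g t) =
  a * charge_integral mu f + charge_integral mu g.
Proof.
move=> cf cg; rewrite /charge_integral.
have caf : continuous (fun t => a * f t) by cts.
by rewrite !RintD// !RintZ//; ring.
Qed.

(** Outer regularity of A and of its complement traps A between a closed and
    an open set. *)
Lemma outer_regular (m : {finite_measure set (borel K) -> \bar R}) :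
  (forall (A : set K) e, 0 < e ->
      exists U : set K, [/\ open U, A `<=` U & (m U < m A + e%:E)%E]) ->
  regular (charge_of_finite_measure m).
Proof.
move=> m_out A mA e e0; have e20 : 0 < e / 2 by rewrite divr_gt0.
have [U [oU AU mU]] := m_out A _ e20; have [V [oV AV mV]] := m_out (~` A) _ e20.
exists (~` V), U; split => //; first exact: open_closedC.
  by move=> t nVt; apply: contrapT => /AV.
have mbU : measurable (U : set (borel K)) by exact: open_borel.
have mbV : measurable (V : set (borel K)) by exact: open_borel.
have mcA : measurable (~` A) by exact: measurableC.
have split_lt (B : set (borel K)) (W : set (borel K)) : measurable B -> measurable W ->
    B `<=` W -> (m W < m B + (e / 2)%:E)%E -> (m (W `\` B) < (e / 2)%:E)%E.
  move=> mB mW BW; rewrite -{1}(setDUK BW) measureU//;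
    [|exact: measurableD|by rewrite setDIK].
  by rewrite lteD2lE// fin_num_measure.
have mUA := split_lt _ _ mA mbU AU mU; have mVA := split_lt _ _ mcA mbV AV mV.
have mUV : measurable (U `\` ~` V : set (borel K)).
  by apply: measurableD => //; exact: measurableC.
apply: (@le_lt_trans _ _ (m (U `\` ~` V))).
  apply: charge_abs_min => // B mB.
  by rewrite /charge_of_finite_measure gee0_abs.
apply: (@le_lt_trans _ _ (m ((U `\` A) `|` (V `\` ~` A)))).
  apply: le_measure; rewrite ?inE//.
    by apply: measurableU; apply: measurableD.
  move=> t [Ut /contrapT Vt]; have [At|nAt] := pselect (A t); last by left.
  by right; split => // /(_ At).
apply: (@le_lt_trans _ _ (m (U `\` A) + m (V `\` ~` A))%E).
  by apply: measureU2; exact: measurableD.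
by rewrite [e]splitr EFinD; exact: lteD.
Qed.

End charges.

Section riesz.
Context {R : realType} {K : ptopologicalType}.
Hypotheses (cK : compact [set: K]) (hK : hausdorff_space K).
Variables (L : (K -> R) -> R) (M : R).
Implicit Types (a c : R) (f g : K -> R).
Hypothesis L_linear : forall a f g, continuous f -> continuous g ->
  L (fun t => a * f t + g t) = a * L f + L g.
Hypothesis L_bounded : forall f c, continuous f -> (forall t, `|f t| <= c) ->
  `|L f| <= M * c.

Let LD f g : continuous f -> continuous g -> L (fun t => f t + g t) = L f + L g.
Proof.
move=> cf cg; rewrite -[L f]mul1r -L_linear//.
by congr L; apply/funext => t; rewrite mul1r.
Qed.

Let L0 : L (fun=> 0) = 0.
Proof.
apply/eqP; rewrite -normr_le0; have := @L_bounded (fun=> 0) 0 (@cts_cst _ _ 0).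
by rewrite mulr0; apply => t; rewrite normr0.
Qed.

Let LZ a f : continuous f -> L (fun t => a * f t) = a * L f.
Proof.
move=> cf; rewrite -[RHS]addr0 -L0 -L_linear//; last exact: cts_cst.
by congr L; apply/funext => t; rewrite addr0.
Qed.

Let dominated f g := continuous g /\ forall t, 0 <= g t <= f t.

(** The positive part of L in the dual of C(K), used on nonnegative functions
    only, where it is additive; L is the difference of the two additive
    functionals positive_part and positive_part - L on that cone. *)
Definition positive_part f : R := sup [set L g | g in dominated f].

Let part_has_sup f : nonneg_cts f -> has_sup [set L g | g in dominated f].
Proof.
move=> [cf f0]; split; first by exists (L (fun=> 0)), (fun=> 0) => //; split => [|t];
  [exact: cts_cst|rewrite lexx f0].
have [c fc] := cts_bounded cK cf.
exists (M * c) => _ [g [cg gf] <-]; apply: le_trans (ler_norm _) _;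
  apply: L_bounded => // t.
have /andP[g0 /le_trans gft] := gf t; rewrite ger0_norm//; apply: gft.
exact: le_trans (ler_norm _) (fc t).
Qed.

Let le_part f g : nonneg_cts f -> dominated f g -> L g <= positive_part f.
Proof. by move=> nf dg; apply: ub_le_sup; [case: (part_has_sup nf)|exists g]. Qed.

Let part_le f c : nonneg_cts f -> (forall g, dominated f g -> L g <= c) ->
  positive_part f <= c.
Proof.
move=> nf le_c; apply: ge_sup; first by case: (part_has_sup nf).
by move=> _ [g dg <-]; exact: le_c.
Qed.

Let part_ge0 f : nonneg_cts f -> 0 <= positive_part f.
Proof.
move=> nf; have [_ f0] := nf; rewrite -L0; apply: le_part => //; split => [|t];
  first exact: cts_cst.
by rewrite lexx f0.
Qed.

Let nonnegD f g : nonneg_cts f -> nonneg_cts g -> nonneg_cts (fun t => f t + g t).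
Proof. by move=> [cf f0] [cg g0]; split => [|t]; [cts|rewrite addr_ge0]. Qed.

Let nonnegZ a f : 0 <= a -> nonneg_cts f -> nonneg_cts (fun t => a * f t).
Proof. by move=> a0 [cf f0]; split => [|t]; [cts|rewrite mulr_ge0]. Qed.

(** Riesz decomposition: what lies below f + g is the sum of its minimum
    with f and a remainder below g. *)
Let partD f g : nonneg_cts f -> nonneg_cts g ->
  positive_part (fun t => f t + g t) = positive_part f + positive_part g.
Proof.
move=> nf ng; have nfg := nonnegD nf ng; have [cf f0] := nf; have [cg g0] := ng.
apply/eqP; rewrite eq_le; apply/andP; split.
  apply: part_le => // h [ch hfg].
  pose h1 t : R := Num.min (h t) (f t).
  have ch1 : continuous h1 by rewrite /h1; cts.
  have -> : h = (fun t => h1 t + (h t - h1 t)) by apply/funext => t; rewrite subrKC.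
  have ch2 : continuous (fun t => h t - h1 t) by cts.
  rewrite LD//; apply: lerD; apply: le_part => //; split => // t.
    by have /andP[h0 _] := hfg t; rewrite /h1 le_min h0 f0/= ge_min lexx orbT.
  have /andP[h0 ht] := hfg t; rewrite /h1 subr_ge0 ge_min lexx/=.
  by have := g0 t; rewrite /Num.min; case: ifP; lra.
rewrite -lerBrDr; apply: part_le => // a [ca af]; rewrite lerBrDr -lerBrDl.
apply: part_le => // b [cb bg]; rewrite lerBrDl -LD//; apply: le_part => //.
split => [|t]; first by cts.
by have /andP[? ?] := af t; have /andP[? ?] := bg t; rewrite addr_ge0// lerD.
Qed.

Let partZ a f : 0 <= a -> nonneg_cts f ->
  positive_part (fun t => a * f t) = a * positive_part f.
Proof.
move=> a0 nf; have naf := nonnegZ a0 nf; have [cf f0] := nf.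
have [->|a_neq0] := eqVneq a 0.
  apply/eqP; rewrite mul0r eq_le; apply/andP; split.
    apply: part_le; first exact: nonnegZ.
    move=> g [cg g0]; rewrite (_ : g = fun=> 0) ?L0//; apply/funext => t.
    by apply/eqP; rewrite eq_le; have := g0 t; rewrite mul0r andbC.
  by apply: part_ge0; exact: nonnegZ.
have a_gt0 : 0 < a by rewrite lt_neqAle eq_sym a_neq0.
apply/eqP; rewrite eq_le; apply/andP; split.
  apply: part_le => // g [cg gaf].
  rewrite -ler_pdivrMl// -LZ//; apply: le_part => //; split => [|t]; first by cts.
  have /andP[g0 gt] := gaf t; rewrite mulr_ge0 ?invr_ge0//=.
  by rewrite ler_pdivrMl.
rewrite -ler_pdivlMl//; apply: part_le => // g [cg gf].
rewrite ler_pdivlMl// -LZ//; apply: le_part => //; split => [|t]; first by cts.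
by have /andP[? ?] := gf t; rewrite mulr_ge0//= ler_pM2l.
Qed.

Theorem riesz_representation :
  exists mu : regular_measure R K, forall f, continuous f -> charge_integral mu f = L f.
Proof.
have [|||m1 [m1E m1reg]] := positive_functional_measure cK hK (p := positive_part) => //.
have [|||m2 [m2E m2reg]] := positive_functional_measure cK hK
    (p := fun f => positive_part f - L f).
- move=> f nf; rewrite subr_ge0; apply: le_part => //; have [cf f0] := nf; split => // t.
  by rewrite lexx f0.
- by move=> f g nf ng; rewrite partD// LD; [lra|case: nf|case: ng].
- by move=> a f a0 nf; rewrite partZ// LZ; [ring|case: nf].
pose nu := cadd (charge_of_finite_measure m1) (copp (charge_of_finite_measure m2)).
pose nu0 := crestr0 nu measurableT.
have nu0E A : measurable A -> nu0 A = (m1 A - m2 A)%E.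
  by move=> mA; rewrite /nu0 /crestr0 mem_set// /crestr setIT.
have nu0_reg : regular nu0.
  apply: (@regular_dominated _ _ _ (charge_of_finite_measure m1)
    (charge_of_finite_measure m2) 1%:nng); [exact: outer_regular|exact: outer_regular|].
  move=> A mA; rewrite mul1e; have := lee_abs_sub (m1 A) (m2 A).
  rewrite -(nu0E A mA) => /le_trans; apply.
  by apply: leeD; exact: (abse_charge_variation (svalP (hahn (charge_of_finite_measure
    _)))).
have nu0_off (A : set (borel K)) : ~ measurable A -> nu0 A = 0%E.
  by move=> nmA; rewrite /nu0 /crestr0 memNset.
exists (RegularMeasure nu0_reg nu0_off) => f cf.
rewrite (charge_integralE cK cf nu0E).
have [fp [fn [nfp nfn fE]]] := cts_pos_neg cf.
have [[cfp _] [cfn _]] := (nfp, nfn).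
have cmfn : continuous (fun t => -1 * fn t) by cts.
rewrite fE L_linear// !RintD// !RintZ//.
by rewrite -!m1E// -!m2E//; ring.
Qed.

End riesz.

(** * Symmetric multilinear forms on lists *)

Section polynomial_identities.
Variable R : realType.

(** Natural numbers are enough values, so that a polynomial identity in a real
    variable may also be tested on nonnegative reals only. *)
Lemma poly_eq_of_nat_values (p q : {poly R}) : (forall i : nat, p.[i%:R] = q.[i%:R]) ->
  p = q.
Proof.
move=> pq; apply/eqP; rewrite -subr_eq0; apply/eqP.
pose rs := [seq i%:R : R | i <- iota 0 (size (p - q))].
apply: (@roots_geq_poly_eq0 _ _ rs).
- by apply/allP => _ /mapP[i _ ->]; rewrite /root hornerD hornerN pq subrr.
- by rewrite map_inj_uniq ?iota_uniq//; exact: mulrIn.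
- by rewrite size_map size_iota.
Qed.

End polynomial_identities.

Lemma perm_middle (T : eqType) (w : T) r s : perm_eq (s ++ w :: r) (w :: s ++ r).
Proof. by apply/permPl; exact: (perm_catCA s [:: w] r). Qed.

Section symmetric_forms.
Context {R : realType} {K : ptopologicalType}.
Hypothesis cK : compact [set: K].
Local Notation C := (continuousType K R).
Implicit Types (F : seq C -> R) (x y z u : C) (r s t : seq C).

(** Symmetric multilinear forms on lists of vectors: by symmetry, linearity is
    only needed at the head. Lists make it possible to fix some of the
    arguments and to induct on the number of the remaining ones. *)
Record sym_form F (c : R) : Prop := SymForm {
  sf_lin : forall a y z s, F (a *: y + z :: s) = a * F (y :: s) + F (z :: s) ;
  sf_perm : forall s t, perm_eq s t -> F s = F t ;
  sf_bound : forall s, `|F s| <= c * \prod_(x <- s) C_norm x }.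

Definition seq_form n (A : ('I_n -> C) -> R) : seq C -> R :=
  fun s => if size s == n then A (fun i => nth 0 s i) else 0.

Lemma seq_form_sym n (A : ('I_n -> C) -> R) : multilinear A -> bounded_form A ->
  Defs.symmetric_form A -> exists2 c, 0 <= c & sym_form (seq_form A) c.
Proof.
move=> mA [c Ac] sA; exists `|c| => //; split.
- move=> a y z s; rewrite /seq_form/=; case: ifPn => [/eqP sn|_];
  last by rewrite mulr0 addr0.
  case: n A mA Ac sA sn => // n A mA _ _ _.
  have consE w : (fun i : 'I_n.+1 => nth 0 (w :: s) i) = dfwith (fun i : 'I_n.+1 =>
    nth 0 (0 :: s) i) ord0 w.
    apply/funext => i; have [->|i0] := eqVneq i ord0; first by rewrite dfwithin.
    rewrite dfwithout 1?eq_sym//; case: i i0 => -[|i] //= ilt.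
  by rewrite (consE (a *: y + z)) (consE y) (consE z) mA.
- move=> s t st; rewrite /seq_form (perm_size st); case: eqP => // tn.
  pose tt := Tuple (introT eqP tn).
  have /tuple_permP[p ->] : perm_eq s tt by [].
  rewrite -[RHS](sA p); congr A; apply/funext => i.
  by rewrite (nth_map i) ?size_enum_ord// nth_ord_enum (tnth_nth 0).
- move=> s; rewrite /seq_form; case: eqP => [sn|_]; last first.
    by rewrite normr0 mulr_ge0// prodr_ge0// => x _; exact: (C_norm_ge0 cK).
  apply: le_trans (Ac _) _; rewrite [X in _ * X <= _](_ : _ = \prod_(x <- s) C_norm x);
    last first.
    by rewrite (big_nth 0) sn big_mkord.
  by rewrite ler_wpM2r ?ler_norm// prodr_ge0// => x _; exact: (C_norm_ge0 cK).
Qed.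

Lemma form_of_seq n P (A : ('I_n -> C) -> R) : form_of P A ->
  forall x, P x = seq_form A (nseq n x).
Proof.
move=> [_ _ _ PA] x; rewrite PA /seq_form size_nseq eqxx; congr A.
by apply/funext => i; rewrite nth_nseq ltn_ord.
Qed.

Section fixed_form.
Variables (F : seq C -> R) (c : R).
Hypotheses (c0 : 0 <= c) (symF : sym_form F c).

Lemma sym_formD y z s : F (y + z :: s) = F (y :: s) + F (z :: s).
Proof. by have := sf_lin symF 1 y z s; rewrite scale1r mul1r. Qed.

Lemma sym_form0 s : F (0 :: s) = 0.
Proof. by have := sym_formD 0 0 s; rewrite addr0; lra. Qed.

Lemma sym_formZ a y s : F (a *: y :: s) = a * F (y :: s).
Proof. by have := sf_lin symF a y 0 s; rewrite sym_form0 !addr0. Qed.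

Lemma sym_form_cons z : sym_form (fun s => F (z :: s)) (c * C_norm z).
Proof.
split=> [a x y s|s t st|s].
- have swap w : F (z :: w :: s) = F (w :: z :: s).
    by apply: (sf_perm symF); apply/permPl; exact: (perm_catCA [:: z] [:: w] s).
  by rewrite !swap (sf_lin symF).
- by apply: (sf_perm symF); rewrite perm_cons.
- by apply: le_trans (sf_bound symF _) _; rewrite big_cons mulrA.
Qed.

(** The derivative at 0 picks one of the m equal arguments in turn. *)
Lemma form_along_line m x u r : exists p : {poly R},
  (forall a : R, F (nseq m (x + a *: u) ++ r) = p.[a]) /\
  p^`().[0] = m%:R * F (u :: nseq m.-1 x ++ r).
Proof.
elim: m r => [|m IHm] r.
  by exists (F r)%:P; split => [a|]; rewrite ?hornerC//= derivC hornerC mul0r.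
have [p1 [p1E p1D]] := IHm (x :: r); have [p2 [p2E p2D]] := IHm (u :: r).
have perm1 w v : F (nseq m v ++ w :: r) = F (w :: nseq m v ++ r).
  by apply: (sf_perm symF); exact: perm_middle.
exists (p1 + 'X * p2); split => [a|].
  rewrite /= addrC (sf_lin symF) -!perm1 addrC p1E p2E.
  by rewrite hornerD hornerM hornerX addrC.
rewrite derivD derivM derivX mul1r !hornerD hornerM hornerX mul0r addr0 p1D.
rewrite -p2E scale0r addr0 perm1/= -natr1 mulrDl mul1r; congr (_ + _).
case: m {IHm p1E p1D p2E p2D perm1} => [|m]; first by rewrite !mul0r.
congr (_ * _); apply: (sf_perm symF); rewrite perm_cons/=.
exact: perm_middle.
Qed.

(** The step of polarization: one argument is replaced by an arbitrary vector u. *)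
Lemma form_line_zero m x u r :
  (forall a : R, F (nseq m.+1 (x + a *: u) ++ r) = 0) -> F (u :: nseq m x ++ r) = 0.
Proof.
move=> h; have [p [pE pD]] := form_along_line m.+1 x u r.
have p0 : p = 0 by apply: poly_eq_of_nat_values => a; rewrite -pE h horner0.
move/eqP: pD; rewrite p0 deriv0 horner0 eq_sym mulf_eq0 pnatr_eq0/=.
by move/eqP.
Qed.

(** Telescoping: the two lists are exchanged one entry at a time, and each exchange
    costs e times the norms of the other entries. *)
Lemma form_lipschitz M e s t r : size s = size t -> 0 <= e -> 
  {in s ++ t ++ r, forall x, C_norm x <= M} ->
  (forall i, C_norm (nth 0 s i - nth 0 t i) <= e) ->
  `|F (s ++ r) - F (t ++ r)| <= (size s)%:R * (c * M ^+ (size s + size r).-1) * e.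
Proof.
move=> + e0; elim: s t r => [|x s IHs] [|y t] r //= st.
  by rewrite subrr normr0 !mul0r.
case: st => st bM near_st.
have swap w v : F (w ++ v :: r) = F (v :: w ++ r).
  by apply: (sf_perm symF); exact: perm_middle.
have -> : F (x :: s ++ r) - F (y :: t ++ r) =
    F ((x - y) :: s ++ r) + (F (s ++ y :: r) - F (t ++ y :: r)).
  by rewrite !swap -{1}[x](subrK y) [F (x - y + y :: _)]sym_formD; ring.
apply: le_trans (ler_normD _ _) _.
rewrite -natr1 mulrDl mulrDl mul1r addrC; apply: lerD.
  have := IHs t (y :: r) st; rewrite /= !addnS/= => h; apply: h.
    move=> w; rewrite !(mem_cat, inE) => wP; apply: bM.
    by move: wP; rewrite !(mem_cat, inE); do ?case: (_ \in _) => //=; rewrite ?orbT//;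
      case: (w == y) => //=; rewrite ?orbT.
  by move=> i; exact: (near_st i.+1).
apply: le_trans (sf_bound symF _) _; rewrite big_cons.
rewrite -mulrA [X in _ <= _ * X]mulrC ler_wpM2l// ler_pM//.
- exact: (C_norm_ge0 cK).
- by apply: prodr_ge0 => w _; exact: (C_norm_ge0 cK).
- exact: (near_st 0%N).
rewrite -size_cat -[_ ^+ _]mulr1 -iter_mulr -(count_predT (s ++ r)) -big_const_seq
  big_seq [X in _ <= X]big_seq.
apply: ler_prod => w ws; rewrite (C_norm_ge0 cK)/= bM//.
by move: ws; rewrite !(mem_cat, inE) => /orP[] ->; rewrite ?orbT.
Qed.

End fixed_form.
End symmetric_forms.

(** * Forms that vanish on disjoint arguments *)

Section orthosymmetry.
Context {R : realType} {K : ptopologicalType}.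
Hypotheses (cK : compact [set: K]) (hK : hausdorff_space K).
Local Notation C := (continuousType K R).
Implicit Types (F : seq C -> R) (x y z : C) (r s : seq C).

Definition disjoint_fun x y := forall t : K, x t * y t = 0.

Lemma sym_form_nseqZ F c m a y r : sym_form F c ->
  F (nseq m (a *: y) ++ r) = a ^+ m * F (nseq m y ++ r).
Proof.
move=> symF; elim: m r => [|m IHm] r; first by rewrite mul1r.
have perm1 w v : F (w :: nseq m v ++ r) = F (nseq m v ++ w :: r).
  by apply: (sf_perm symF); rewrite perm_sym; exact: perm_middle.
by rewrite /= (sym_formZ symF) !perm1 IHm exprS mulrA.
Qed.

Definition block_orthogonal n F := forall x y j k, (j + k).+2 = n ->
  disjoint_fun x y -> F (nseq j.+1 x ++ nseq k.+1 y) = 0.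

(** For every a the polynomial s |-> F((x + (a + s) y)^m, y^i) is known, hence so is
    its derivative at 0, which turns one of the arguments x + a y into y. Induction
    on i, and a = 0 in the end. *)
Lemma additive_block_orthogonal n F c : sym_form F c ->
  (forall x y, disjoint_fun x y -> F (nseq n (x + y)) = F (nseq n x) + F (nseq n y)) ->
  block_orthogonal n F.
Proof.
move=> symF addF x y j k jkn xy.
have main i a : (i <= n)%N -> F (nseq (n - i) (x + a *: y) ++ nseq i y) =
    a ^+ (n - i) * F (nseq n y) + (i == 0%N)%:R * F (nseq n x).
  elim: i a => [|i IHi] a lt_in.
    rewrite subn0 cats0 mul1r [RHS]addrC addF; last first.
      by move=> t; rewrite -[(a *: y) t]/(a * y t) mulrCA xy mulr0.
    by have := sym_form_nseqZ n a y [::] symF; rewrite !cats0 => ->.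
  have [p [pE pD]] := form_along_line symF (n - i) (x + a *: y) y (nseq i y).
  have niS : (n - i = (n - i.+1).+1)%N by rewrite subnS prednK// subn_gt0.
  have pq : p = (a%:P + 'X) ^+ (n - i) * (F (nseq n y))%:P + ((i == 0%N)%:R * F (nseq n
    x))%:P.
    apply: poly_eq_of_nat_values => s; rewrite -pE -addrA -scalerDl IHi ?(ltnW lt_in)//.
    by rewrite !hornerE.
  have <- : F (y :: nseq (n - i.+1) (x + a *: y) ++ nseq i y) =
      F (nseq (n - i.+1) (x + a *: y) ++ nseq i.+1 y).
    by apply: (sf_perm symF); rewrite perm_sym; exact: perm_middle.
  move: pD; rewrite pq niS derivD derivC addr0 derivM derivC mulr0 addr0 deriv_exp/=.
  rewrite derivD derivC derivX add0r mul1r !hornerE.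
  rewrite hornerMn horner_exp hornerD hornerC hornerX addr0 -mulr_natl -mulrA.
  by move=> /(mulfI (_ : _ != 0)) => ->//; rewrite pnatr_eq0.
have /(_ k.+1 0) := main; rewrite scale0r addr0 mul0r addr0.
have -> : (n - k.+1 = j.+1)%N by lia.
by rewrite expr0n mul0r => ->//; lia.
Qed.

Definition soft (e : R) (f : K -> R) : K -> R :=
  fun t => Num.max (f t - e) 0 - Num.max (- f t - e) 0.

Let cts_soft e f : continuous f -> continuous (soft e f).
Proof. by move=> cf; rewrite /soft; cts. Qed.

Let soft_dist e f t : 0 <= e -> `|f t - soft e f t| <= e.
Proof.
move=> e0; rewrite ler_norml /soft /Num.max.
by case: ifPn; case: ifPn; rewrite -?leNgt; lra.
Qed.

Let soft_le e f t : 0 <= e -> `|soft e f t| <= `|f t|.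
Proof.
move=> e0; rewrite ler_norml /soft /Num.max; have := ler_norm (f t).
have := ler_norm (- f t); rewrite normrN.
by case: ifPn; case: ifPn; rewrite -?leNgt; lra.
Qed.

Let soft0 e f t : 0 <= e -> `|f t| <= e -> soft e f t = 0.
Proof.
move=> e0; rewrite ler_norml /soft /Num.max.
by case: ifPn; case: ifPn; rewrite -?leNgt; lra.
Qed.

(** After soft thresholding, disjoint functions are separated by a Urysohn
    function theta; any z is then theta z + (1 - theta) z, where the first
    part is disjoint from y and the second one from x. *)
Lemma block_orthogonal_cons n F c z : 0 <= c -> sym_form F c ->
  block_orthogonal n.+1 F -> block_orthogonal n (fun s => F (z :: s)).
Proof.
move=> c0 symF oF x y j k jkn xy.
have symFz := sym_form_cons symF z.
have cz0 : 0 <= c * C_norm z by rewrite mulr_ge0// (C_norm_ge0 cK).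
set s := nseq j.+1 x ++ nseq k.+1 y.
pose M := C_norm x + C_norm y.
pose Q := (size s)%:R * (c * C_norm z * M ^+ (size s).-1).
suff small e : 0 < e -> `|F (z :: s)| <= Q * e.
  have Q0 : 0 <= Q.
    by rewrite /Q !mulr_ge0 ?exprn_ge0 ?addr_ge0 ?(C_norm_ge0 cK)//.
  have Q1 : 0 < Q + 1 by rewrite ltr_wpDl.
  apply/eqP; rewrite -normr_le0; apply/ler_addgt0Pr => e e0; rewrite add0r.
  apply: le_trans (small (e / (Q + 1)) _) _; first by rewrite divr_gt0.
  by rewrite mulrCA ler_piMr ?(ltW e0)// ler_pdivrMr// mul1r lerDl.
move=> e0; have e_ge0 := ltW e0.
pose x' := C_of (soft e x); pose y' := C_of (soft e y).
have x'E t : x' t = soft e x t by rewrite C_ofE//; apply: cts_soft; cts.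
have y'E t : y' t = soft e y t by rewrite C_ofE//; apply: cts_soft; cts.
have [u [cu u01 u0 u1]] : exists u : K -> R, [/\ continuous u,
    forall t, 0 <= u t <= 1, forall t, [set t | e <= `|y t|] t -> u t = 0
    & forall t, [set t | e <= `|x t|] t -> u t = 1].
  apply: urysohn => //; try by apply: closed_ge; cts.
  apply/seteqP; split => // t [/= ey ex]; have /eqP := xy t; rewrite mulf_eq0.
  by rewrite -normr_eq0 -[y t == 0]normr_eq0 !gt_eqF// (lt_le_trans e0).
pose z1 := C_of (fun t => u t * z t); pose z2 := C_of (fun t => (1 - u t) * z t).
have z1E t : z1 t = u t * z t by rewrite C_ofE//; cts.
have z2E t : z2 t = (1 - u t) * z t by rewrite C_ofE//; cts.
have zE : z = z1 + z2.
  by apply/continuousEP => t; rewrite -[RHS]/(z1 t + z2 t) z1E z2E; ring.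
have x'0 t : u t != 1 -> x' t = 0.
  move=> ut; rewrite x'E soft0// ltW// ltNge; apply: contra ut => ext.
  by rewrite u1.
have y'0 t : u t != 0 -> y' t = 0.
  move=> ut; rewrite y'E soft0// ltW// ltNge; apply: contra ut => eyt.
  by rewrite u0.
have xy' : disjoint_fun x' y'.
  move=> t; have [ut|/y'0 ->] := eqVneq (u t) 0; last by rewrite mulr0.
  by rewrite x'0 ?mul0r// ut eq_sym oner_neq0.
have Fz0 : F (z :: nseq j.+1 x' ++ nseq k.+1 y') = 0.
  rewrite zE (sym_formD symF).
  have -> : F (z1 :: nseq j.+1 x' ++ nseq k.+1 y') = 0.
    apply: (form_line_zero symF) => a; apply: oF; first by lia.
    move=> t; rewrite -[(x' + a *: z1) t]/(x' t + a * z1 t) z1E mulrDl xy' add0r.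
    by have [->|/y'0 ->] := eqVneq (u t) 0; rewrite ?mulr0// mul0r mulr0 mul0r.
  have -> : F (z2 :: nseq j.+1 x' ++ nseq k.+1 y') = 0.
    rewrite (sf_perm symF (_ : perm_eq _ (z2 :: nseq k.+1 y' ++ nseq j.+1 x'))); last first.
      by rewrite perm_cons perm_catC.
    apply: (form_line_zero symF) => a; rewrite (sf_perm symF (_ : perm_eq _
      (nseq j.+1 x' ++ nseq k.+2 (y' + a *: z2)))); last by rewrite perm_catC.
    apply: oF; first by lia.
    move=> t; rewrite -[(y' + a *: z2) t]/(y' t + a * z2 t) z2E mulrDr xy' add0r.
    by have [->|/x'0 ->] := eqVneq (u t) 1; rewrite ?mul0r// subrr mul0r !mulr0.
  by rewrite addr0.
have norm_x' : C_norm x' <= C_norm x.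
  apply: C_norm_le => t; apply: le_trans (C_norm_ub cK x t).
  by rewrite x'E; exact: soft_le.
have norm_y' : C_norm y' <= C_norm y.
  apply: C_norm_le => t; apply: le_trans (C_norm_ub cK y t).
  by rewrite y'E; exact: soft_le.
have := @form_lipschitz _ _ cK _ _ cz0 symFz M e s (nseq j.+1 x' ++ nseq k.+1 y') [::].
rewrite !cats0 Fz0 subr0 addn0; apply => //.
- by rewrite !size_cat !size_nseq.
- have [nx ny] := (C_norm_ge0 cK x, C_norm_ge0 cK y).
  move=> w; rewrite !(mem_cat, mem_nseq)/=.
  by rewrite /M => /orP[/orP[]|/orP[]] /eqP ->; lra.
- move=> i; rewrite !nth_cat !size_nseq !nth_nseq.
  apply: C_norm_le => t; case: (ltnP i j.+1) => _ /=.
    by rewrite -[(x - x') t]/(x t - x' t) x'E; exact: soft_dist.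
  case: (ltnP (i - j.+1) k.+1) => _ /=; last first.
    by change (`|0 - 0 : R| <= e); rewrite subrr normr0.
  by rewrite -[(y - y') t]/(y t - y' t) y'E; exact: soft_dist.
Qed.

(** For two arguments the two notions coincide; the other arguments are fixed
    one at a time. *)
Lemma block_orthogonal_orthosymmetric m F c : 0 <= c -> sym_form F c ->
  block_orthogonal m.+2 F ->
  forall x y s, size s = m -> disjoint_fun x y -> F (x :: y :: s) = 0.
Proof.
elim: m F c => [|m IHm] F c c0 symF oF x y s.
  by move=> /size0nil -> xy; exact: (oF x y 0%N 0%N).
case: s => // z s [sm] xy.
have -> : F (x :: y :: z :: s) = F (z :: x :: y :: s).
  by apply: (sf_perm symF); exact: (perm_middle z s [:: x; y]).
have cz0 : 0 <= c * C_norm z by rewrite mulr_ge0// (C_norm_ge0 cK).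
apply: (IHm (fun s => F (z :: s)) _ cz0 (sym_form_cons symF z)) => //.
exact: (block_orthogonal_cons _ c0 symF oF).
Qed.

End orthosymmetry.

(** * Balanced bilinear forms *)

Section balanced.
Context {R : realType} {K : ptopologicalType}.
Hypothesis cK : compact [set: K].
Variables (b : (K -> R) -> (K -> R) -> R) (M : R).
Implicit Types (f g x y : K -> R) (c : R).
Hypothesis b_linl : forall a f g y, continuous f -> continuous g -> continuous y ->
  b (fun t => a * f t + g t) y = a * b f y + b g y.
Hypothesis b_linr : forall a x f g, continuous x -> continuous f -> continuous g ->
  b x (fun t => a * f t + g t) = a * b x f + b x g.
Hypothesis b_bounded : forall f g c1 c2, continuous f -> continuous g ->
  (forall t, `|f t| <= c1) -> (forall t, `|g t| <= c2) -> `|b f g| <= M * c1 * c2.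
Hypothesis b_ortho : forall f g, continuous f -> continuous g ->
  (forall t, f t * g t = 0) -> b f g = 0.

Let bDl f g y : continuous f -> continuous g -> continuous y ->
  b (fun t => f t + g t) y = b f y + b g y.
Proof.
move=> cf cg cy; rewrite -[b f y]mul1r -b_linl//.
by congr (b _ y); apply/funext => t; rewrite mul1r.
Qed.

Let bDr x f g : continuous x -> continuous f -> continuous g ->
  b x (fun t => f t + g t) = b x f + b x g.
Proof.
move=> cx cf cg; rewrite -[b x f]mul1r -b_linr//.
by congr (b x _); apply/funext => t; rewrite mul1r.
Qed.

Let b0l y : continuous y -> b (fun=> 0) y = 0.
Proof. by move=> cy; apply: b_ortho => // [|t]; [exact: cts_cst|rewrite mul0r]. Qed.

Let b0r x : continuous x -> b x (fun=> 0) = 0.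
Proof. by move=> cx; apply: b_ortho => // [|t]; [exact: cts_cst|rewrite mulr0]. Qed.

Let bZl a f y : continuous f -> continuous y -> b (fun t => a * f t) y = a * b f y.
Proof.
move=> cf cy; rewrite -[RHS]addr0 -(b0l cy) -b_linl//; last exact: cts_cst.
by congr (b _ y); apply/funext => t; rewrite addr0.
Qed.

Let bZr a x f : continuous x -> continuous f -> b x (fun t => a * f t) = a * b x f.
Proof.
move=> cx cf; rewrite -[RHS]addr0 -(b0r cx) -b_linr//; last exact: cts_cst.
by congr (b x _); apply/funext => t; rewrite addr0.
Qed.

Let b_suml I (r : seq I) (P : pred I) (u : I -> K -> R) y :
  (forall i, continuous (u i)) -> continuous y ->
  b (fun t => \sum_(i <- r | P i) u i t) y = \sum_(i <- r | P i) b (u i) y.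
Proof.
move=> cu cy; elim: r => [|i r IHr].
  by rewrite big_nil -[RHS](b0l cy); congr (b _ y); apply/funext => t; rewrite big_nil.
have cs : continuous (fun t => \sum_(i <- r | P i) u i t) by cts.
rewrite big_cons; case: ifPn => Pi; rewrite -IHr -?bDl//.
  by congr (b _ y); apply/funext => t; rewrite big_cons Pi.
by congr (b _ y); apply/funext => t; rewrite big_cons (negbTE Pi).
Qed.

Let b_sumr I (r : seq I) (P : pred I) x (v : I -> K -> R) :
  continuous x -> (forall i, continuous (v i)) ->
  b x (fun t => \sum_(i <- r | P i) v i t) = \sum_(i <- r | P i) b x (v i).
Proof.
move=> cx cv; elim: r => [|i r IHr].
  by rewrite big_nil -[RHS](b0r cx); congr (b x _); apply/funext => t; rewrite big_nil.
have cs : continuous (fun t => \sum_(i <- r | P i) v i t) by cts.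
rewrite big_cons; case: ifPn => Pi; rewrite -IHr -?bDr//.
  by congr (b x _); apply/funext => t; rewrite big_cons Pi.
by congr (b x _); apply/funext => t; rewrite big_cons (negbTE Pi).
Qed.

Let sum_at_most_one (I : finType) (P : pred I) (F : I -> R) c : 0 <= c ->
  (forall i, `|F i| <= c) ->
  (forall i j, P i -> P j -> F i != 0 -> F j != 0 -> i = j) ->
  `|\sum_(i | P i) F i| <= c.
Proof.
move=> c0 Fc F1; have [/existsP[i /andP[Pi Fi]]|/existsPn none] :=
    boolP [exists i, P i && (F i != 0)].
  rewrite (bigD1 i)//= big1 ?addr0// => j /andP[Pj ji]; apply/eqP.
  by apply: contraNT ji => Fj; rewrite (F1 j i).
rewrite big1 ?normr0// => i Pi; apply/eqP.
by have := none i; rewrite Pi negbK.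
Qed.

(** Almost diagonal families: the cross terms vanish by orthogonality, so the
    sum of the b (u j) (v j) is one value of b, at bounded functions. *)
Let diagonal_sum (I : finType) (P : pred I) (u v : I -> K -> R) c1 c2 :
  0 <= c1 -> 0 <= c2 ->
  (forall i, continuous (u i)) -> (forall i, continuous (v i)) ->
  (forall i t, `|u i t| <= c1) -> (forall i t, `|v i t| <= c2) ->
  (forall i j t, P i -> P j -> u i t != 0 -> u j t != 0 -> i = j) ->
  (forall i j t, P i -> P j -> v i t != 0 -> v j t != 0 -> i = j) ->
  (forall i j t, P i -> P j -> u i t != 0 -> v j t != 0 -> i = j) ->
  `|\sum_(i | P i) b (u i) (v i)| <= M * c1 * c2.
Proof.
move=> c10 c20 cu cv u1 v1 uu vv uv.
have -> : \sum_(i | P i) b (u i) (v i) =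
    b (fun t => \sum_(i | P i) u i t) (fun t => \sum_(i | P i) v i t).
  rewrite b_suml//; last by cts.
  apply: eq_bigr => i Pi; rewrite b_sumr// (bigD1 i)//= big1 ?addr0// => j /andP[Pj ji].
  apply: b_ortho => // t; apply/eqP; rewrite mulf_eq0; apply: contraNT ji.
  by rewrite negb_or => /andP[ui vj]; rewrite (uv i j t).
apply: b_bounded; [by cts|by cts| |] => t; apply: sum_at_most_one => // i j.
  exact: uu.
exact: vv.
Qed.

Let hat (r : R) : R := Num.max (1 - `|r|) 0.
Let wide_hat (r : R) : R := Num.min 1 (Num.max (2 - `|r|) 0).

Let hat_sum (N : nat) (r : R) : 0 <= r ->
  \sum_(j < N.+1) hat (r - j%:R) = Num.min 1 (Num.max (N.+1%:R - r) 0).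
Proof.
move=> r0; elim: N => [|N IHN].
  rewrite big_ord1 /hat /= subr0 ger0_norm// mulr1n min_r// ge_max ler01 andbT.
  by rewrite gerBl.
rewrite big_ord_recr/= IHN /hat -(natr1 N.+1) -(natr1 N); have := ler0n R N.
have [h|h] := leP 0 (r - (N%:R + 1)).
  rewrite (ger0_norm h) /Num.min /Num.max.
  by do ![case: ifPn => //]; rewrite -?leNgt; lra.
rewrite (ltr0_norm h) /Num.min /Num.max.
by do ![case: ifPn => //]; rewrite -?leNgt; lra.
Qed.

Let hat_neq0 r : hat r != 0 -> `|r| < 1.
Proof. by apply: contraNT; rewrite -leNgt => r1; rewrite /hat max_r// subr_le0. Qed.

Let wide_hat_neq0 r : wide_hat r != 0 -> `|r| < 2.
Proof.
apply: contraNT; rewrite -leNgt => r2; rewrite /wide_hat [Num.max _ _]max_r ?subr_le0//.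
by rewrite min_r.
Qed.

Let wide_hat1 r : `|r| < 1 -> wide_hat r = 1.
Proof. by move=> r1; rewrite /wide_hat min_l// le_max; apply/orP; left; lra. Qed.

Let same_class (N k : nat) (i j : 'I_N) (r : R) (c1 c2 : R) : c1 + c2 <= 4 ->
  (i %% 4 == k)%N -> (j %% 4 == k)%N -> `|r - i%:R| < c1 -> `|r - j%:R| < c2 -> i = j.
Proof.
move=> c12 /eqP ik /eqP jk; rewrite !ltr_norml => /andP[i1 i2] /andP[j1 j2].
apply/val_inj/eqP => /=; rewrite eqn_leq; apply/andP; split; rewrite leqNgt;
  apply/negP => lt.
  have : (j + 4 <= i)%N by lia.
  by rewrite -(ler_nat R) natrD; lra.
have : (i + 4 <= j)%N by lia.
by rewrite -(ler_nat R) natrD; lra.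
Qed.

(** The bound does not depend on g: cut x by the hats of width 2 centred at the
    integers j in the range of g, and y by wider hats equal to 1 there. On the j-th
    piece g may be replaced by g - j, which is bounded by 2, and the pieces with
    a given residue of j modulo 4 are almost diagonal. *)
Let almost_balanced g x y X Y : nonneg_cts g -> continuous x -> continuous y ->
  (forall t, `|x t| <= X) -> (forall t, `|y t| <= Y) ->
  `|b (fun t => g t * x t) y - b x (fun t => g t * y t)| <= 12%:R * (M * X * Y).
Proof.
move=> [cg g0] cx cy xX yY.
have X0 : 0 <= X by exact: le_trans (xX point).
have Y0 : 0 <= Y by exact: le_trans (yY point).
have [c gc] := cts_bounded cK cg.
pose N := (Num.truncn c).+1.
have gN t : g t <= N%:R.
  exact: le_trans (ler_norm _) (le_trans (gc t) (ltW (truncnS_gt _))).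
pose ph (j : 'I_N.+1) (t : K) := hat (g t - j%:R).
pose ps (j : 'I_N.+1) (t : K) := wide_hat (g t - j%:R).
have cph j : continuous (ph j) by rewrite /ph /hat; cts.
have cps j : continuous (ps j) by rewrite /ps /wide_hat; cts.
have ph_sum t : \sum_j ph j t = 1.
  rewrite hat_sum// min_l// le_max -natr1; have := gN t => ?.
  by apply/orP; left; lra.
have ph01 j t : 0 <= ph j t <= 1.
  by rewrite /ph /hat le_max lexx orbT ge_max ler01 andbT gerBl normr_ge0.
have ps01 j t : 0 <= ps j t <= 1.
  by rewrite /ps /wide_hat le_min ler01 le_max lexx orbT ge_min lexx.
pose u (j : 'I_N.+1) (t : K) := (g t - j%:R) * (ph j t * x t).
pose v (j : 'I_N.+1) (t : K) := ps j t * y t.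
pose w (j : 'I_N.+1) (t : K) := ph j t * x t.
pose z (j : 'I_N.+1) (t : K) := (g t - j%:R) * (ps j t * y t).
have cu j : continuous (u j) by rewrite /u; cts.
have cv j : continuous (v j) by rewrite /v; cts.
have cw j : continuous (w j) by rewrite /w; cts.
have cz j : continuous (z j) by rewrite /z; cts.
have -> : b (fun t => g t * x t) y - b x (fun t => g t * y t) =
    \sum_j (b (u j) (v j) - b (w j) (z j)).
  have xE : x = (fun t => \sum_j w j t).
    by apply/funext => t; rewrite -mulr_suml ph_sum mul1r.
  have gxE : (fun t => g t * x t) = (fun t => \sum_j (g t * w j t)).
    by apply/funext => t; rewrite {1}xE mulr_sumr.
  rewrite gxE [b x _](_ : _ = b (fun t => \sum_j w j t) (fun t => g t * y t));
    last by rewrite -xE.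
  have cgw j : continuous (fun t => g t * w j t) by cts.
  rewrite !b_suml//; last by cts.
  rewrite -sumrB; apply: eq_bigr => j _.
  pose y1 (t : K) := (1 - ps j t) * y t.
  have cy1 : continuous y1 by rewrite /y1; cts.
  have wy1 t : w j t * y1 t = 0.
    have [ph0|/hat_neq0 lt1] := eqVneq (ph j t) 0; first by rewrite /w ph0 !mul0r.
    by rewrite /y1 /ps wide_hat1// subrr mul0r mulr0.
  have yE : y = (fun t => v j t + y1 t).
    by apply/funext => t; rewrite /v /y1 -mulrDl addrC subrK mul1r.
  have gyE : (fun t => g t * y t) = (fun t => 1 * z j t + (j%:R * v j t + g t * y1 t)).
    by apply/funext => t; rewrite {1}yE /z /v; ring.
  have cgy1 : continuous (fun t => g t * y1 t) by cts.
  have cjv : continuous (fun t => j%:R * v j t + g t * y1 t) by cts.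
  rewrite gyE b_linr// b_linr// [b (w j) (fun t => g t * y1 t)]b_ortho//; last first.
    by move=> t; rewrite mulrCA wy1 mulr0.
  have -> : (fun t => g t * w j t) = (fun t => j%:R * w j t + u j t).
    by apply/funext => t; rewrite /u /w; ring.
  have -> : b (fun t => j%:R * w j t + u j t) y =
      b (fun t => j%:R * w j t + u j t) (v j).
    have cc : continuous (fun t => j%:R * w j t + u j t) by cts.
    rewrite {1}yE bDr// [X in _ + X]b_ortho ?addr0// => t.
    by rewrite /u mulrDl -!mulrA [ph j t * _]mulrA wy1 !mulr0 addr0.
  by rewrite b_linl//; ring.
have -> : \sum_j (b (u j) (v j) - b (w j) (z j)) =
    \sum_(k < 4) (\sum_(j : 'I_N.+1 | (j %% 4 == k)%N) b (u j) (v j) -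
                  \sum_(j : 'I_N.+1 | (j %% 4 == k)%N) b (w j) (z j)).
  under [RHS]eq_bigr do rewrite -sumrB.
  rewrite (partition_big (fun j : 'I_N.+1 => inord (j %% 4) : 'I_4) xpredT)//=.
  apply: eq_bigr => k _; apply: eq_bigl => j.
  by rewrite -val_eqE/= inordK// ltn_pmod.
apply: le_trans (ler_norm_sum _ _ _) _.
apply: le_trans (_ : \sum_(k < 4) (M * X * Y + M * X * (2 * Y)) <= _); last first.
  by rewrite sumr_const card_ord -mulr_natl; lra.
have u_neq0 j t : u j t != 0 -> `|g t - j%:R| < 1.
  by rewrite /u !mulf_eq0 !negb_or => /and3P[_ /hat_neq0].
have w_neq0 j t : w j t != 0 -> `|g t - j%:R| < 1.
  by rewrite /w !mulf_eq0 !negb_or => /andP[/hat_neq0].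
have v_neq0 j t : v j t != 0 -> `|g t - j%:R| < 2.
  by rewrite /v !mulf_eq0 !negb_or => /andP[/wide_hat_neq0].
have z_neq0 j t : z j t != 0 -> `|g t - j%:R| < 2.
  by rewrite /z !mulf_eq0 !negb_or => /and3P[_ /wide_hat_neq0].
have cut_le (r q B : R) : 0 <= r <= 1 -> `|q| <= B -> 0 <= B -> `|r * q| <= B.
  by move=> /andP[r0 r1] qB B0; rewrite normrM ger0_norm// -[B]mul1r ler_pM.
apply: ler_sum => k _; apply: le_trans (ler_normB _ _) _; apply: lerD.
  apply: diagonal_sum => //.
  - move=> j t; have [->|/u_neq0/ltW lt1] := eqVneq (u j t) 0; first by rewrite normr0.
    rewrite normrM -[X]mul1r ler_pM//; exact: cut_le.
  - by move=> j t; exact: cut_le.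
  - by move=> i j t ik jk /u_neq0 h1 /u_neq0; apply: (same_class _ ik jk h1); lra.
  - by move=> i j t ik jk /v_neq0 h1 /v_neq0; apply: (same_class _ ik jk h1); lra.
  - by move=> i j t ik jk /u_neq0 h1 /v_neq0; apply: (same_class _ ik jk h1); lra.
apply: diagonal_sum => //; first by rewrite mulr_ge0.
- by move=> j t; exact: cut_le.
- move=> j t; have [->|/z_neq0/ltW lt1] := eqVneq (z j t) 0.
    by rewrite normr0 mulr_ge0.
  rewrite normrM ler_pM//; exact: cut_le.
- by move=> i j t ik jk /w_neq0 h1 /w_neq0; apply: (same_class _ ik jk h1); lra.
- by move=> i j t ik jk /z_neq0 h1 /z_neq0; apply: (same_class _ ik jk h1); lra.
- by move=> i j t ik jk /w_neq0 h1 /z_neq0; apply: (same_class _ ik jk h1); lra.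
Qed.

(** The previous bound for k g, with k a natural number, is k times the difference
    for g; so the difference is 0. *)
Lemma orthosymmetric_balanced f x y : continuous f -> continuous x -> continuous y ->
  b (fun t => f t * x t) y = b x (fun t => f t * y t).
Proof.
move=> cf cx cy.
have nonneg_case g : nonneg_cts g -> b (fun t => g t * x t) y = b x (fun t => g t * y t).
  move=> [cg g0]; have [[X xX] [Y yY]] := (cts_bounded cK cx, cts_bounded cK cy).
  apply/eqP; rewrite -subr_eq0 -normr_le0 leNgt; apply/negP => d0.
  set d := `|_| in d0; set B := 12%:R * (M * X * Y).
  have scaled k : k%:R * d <= B.
    have ng : nonneg_cts (fun t => k%:R * g t) by split => [|t]; [cts|rewrite mulr_ge0].
    have := almost_balanced ng cx cy xX yY.
    have -> : (fun t => k%:R * g t * x t) = (fun t => k%:R * (g t * x t)).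
      by apply/funext => t; rewrite mulrA.
    have -> : (fun t => k%:R * g t * y t) = (fun t => k%:R * (g t * y t)).
      by apply/funext => t; rewrite mulrA.
    have [cgx cgy] : continuous (fun t => g t * x t) /\ continuous (fun t => g t * y t).
      by split; cts.
    by rewrite bZl// bZr// -mulrBr normrM ger0_norm.
  have := scaled (Num.truncn (B / d)).+1; rewrite leNgt -ltr_pdivrMr// => /negP; apply.
  exact: truncnS_gt.
have [fp [fn [nfp nfn fE]]] := cts_pos_neg cf.
have [[cfp _] [cfn _]] := (nfp, nfn).
have fqE q : (fun t => f t * q t) = (fun t => -1 * (fn t * q t) + fp t * q t).
  by apply/funext => t; rewrite fE; ring.
have [c1 c2] : continuous (fun t => fn t * x t) /\ continuous (fun t =>
  fp t * x t) by split; cts.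
have [c3 c4] : continuous (fun t => fn t * y t) /\ continuous (fun t =>
  fp t * y t) by split; cts.
by rewrite !fqE b_linl// b_linr// !nonneg_case.
Qed.

End balanced.

(** * Orthogonally additive polynomials are integrals of powers *)

Section orthogonally_additive_representation.
Context {R : realType} {K : ptopologicalType}.
Hypotheses (cK : compact [set: K]) (hK : hausdorff_space K).
Local Notation C := (continuousType K R).
Implicit Types (F : seq C -> R) (x y : C) (s : seq C) (f g : K -> R).

(** The form in the first two arguments is balanced, so f can be moved from the
    first argument over to g. *)
Lemma orthosymmetric_product m F c f g s : 0 <= c -> sym_form F c ->
  block_orthogonal m.+2 F -> size s = m -> continuous f -> continuous g ->
  F (C_of f :: C_of g :: s) = F (C_of (fun t => f t * g t) :: C_of (fun=> 1) :: s).
Proof.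
move=> c0 symF oF sm cf cg; pose b f g := F (C_of f :: C_of g :: s).
have bC f' g' : b f' g' = b g' f'.
  by apply: (sf_perm symF); exact: (perm_middle _ s [:: C_of f']).
have linl a f' g' (h' : K -> R) : continuous f' -> continuous g' -> continuous h' ->
    b (fun t => a * f' t + g' t) h' = a * b f' h' + b g' h'.
  by move=> cf' cg' cy; rewrite /b C_ofD// (sf_lin symF).
have linr a (h' : K -> R) f' g' : continuous h' -> continuous f' -> continuous g' ->
    b h' (fun t => a * f' t + g' t) = a * b h' f' + b h' g'.
  by move=> ch' cf' cg'; rewrite !(bC h') linl.
pose B := c * \prod_(w <- s) C_norm w.
have bounded f' g' c1 c2 : continuous f' -> continuous g' ->
    (forall t, `|f' t| <= c1) -> (forall t, `|g' t| <= c2) -> `|b f' g'| <= B * c1 * c2.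
  move=> cf' cg' f1 g2; apply: le_trans (sf_bound symF _) _; rewrite !big_cons.
  have P0 : 0 <= \prod_(w <- s) C_norm w by apply: prodr_ge0 => w _; exact: (C_norm_ge0 cK).
  rewrite [X in _ <= X](_ : _ = c * (c1 * (c2 * \prod_(w <- s) C_norm w)));
    last by rewrite /B; ring.
  rewrite ler_wpM2l// !mulrA ler_wpM2r// ler_pM ?(C_norm_ge0 cK)//.
    by apply: C_norm_le => t; rewrite C_ofE.
  by apply: C_norm_le => t; rewrite C_ofE.
have ortho f' g' : continuous f' -> continuous g' -> (forall t, f' t * g' t = 0) ->
  b f' g' = 0.
  move=> cf' cg' fg.
  apply: (block_orthogonal_orthosymmetric cK hK c0 symF oF sm) => t.
  by rewrite !C_ofE.
have c1 : continuous (fun _ : K => 1 : R) by cts.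
have := orthosymmetric_balanced cK linl linr bounded ortho cg cf c1;
  rewrite -/(b f g) -/(b _ _) (_ : (fun t => g t * 1) = g) => [<-|]; last first.
  by apply/funext => t; rewrite mulr1.
by congr b; apply/funext => t; rewrite mulrC.
Qed.

Lemma power_form m F c x : 0 <= c -> sym_form F c -> block_orthogonal m.+1 F ->
  F (nseq m.+1 x) = F (C_of (fun t => x t ^+ m.+1) :: nseq m (C_of (fun=> 1))).
Proof.
move=> c0 symF; case: m => [|m] oF.
  by rewrite (_ : (fun t => x t ^+ 1) = x) ?C_ofK.
have step l k : (l + k)%N = m.+1 ->
    F (C_of (fun t => x t ^+ l.+1) :: nseq l (C_of (fun=> 1)) ++ nseq k x) =
      F (nseq m.+2 x).
  elim: l k => [k <-|l IHl k lk].
    by rewrite (_ : (fun t => x t ^+ 1) = x) ?C_ofK.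
  rewrite -(IHl k.+1); last by rewrite addnS -addSn.
  rewrite -[X in _ = F (_ :: _ ++ X)]/(x :: nseq k x).
  rewrite (sf_perm symF (_ : perm_eq (C_of (fun t => x t ^+ l.+1) :: _ ++ x :: _)
    (C_of (fun t => x t ^+ l.+1) :: C_of x :: nseq l (C_of (fun=> 1)) ++ nseq k x)));
      last first.
    by rewrite perm_cons C_ofK perm_middle.
  have cx := @cts_fun _ _ x; have cxl : continuous (fun t => x t ^+ l.+1) by cts.
  rewrite (orthosymmetric_product c0 symF oF)//; last by rewrite size_cat !size_nseq; lia.
  by congr (F (C_of _ :: _)); apply/funext => t; rewrite exprSr.
by rewrite -(step m.+1 0%N) ?addn0// cats0.
Qed.

(** P x = L (x ^ n) for the functional L f = A(f, 1, ..., 1), which is an integral by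
    Riesz representation. *)
Theorem orthogonally_additive_integral n (P : C -> R) : (0 < n)%N ->
  homogeneous_polynomial n P -> orthogonally_additive P ->
  exists mu : regular_measure R K, forall x, P x = power_integral n mu x.
Proof.
case: n => // m _ [A formA] oP; have [mA bA sA _] := formA.
have [c c0 symF] := seq_form_sym cK mA bA sA; set F := seq_form A in symF.
have PF x : P x = F (nseq m.+1 x) := form_of_seq formA x.
have oF : block_orthogonal m.+1 F.
  apply: (additive_block_orthogonal symF) => x y xy; rewrite -!PF oP// => t.
  have /eqP := xy t; rewrite mulf_eq0 => /orP[] /eqP ->; rewrite normr0.
    by rewrite min_l.
  by rewrite min_r.
pose one := C_of (fun _ : K => 1 : R); pose L f := F (C_of f :: nseq m one).
have c1 : continuous (fun _ : K => 1 : R) by cts.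
have [||mu muE] := riesz_representation cK hK (L := L) (M := c).
- by move=> a f g cf cg; rewrite /L C_ofD// (sf_lin symF).
- move=> f d cf fd; apply: le_trans (sf_bound symF _) _; rewrite ler_wpM2l// big_cons.
  have d0 : 0 <= d by exact: le_trans (fd point).
  rewrite -[d]mulr1 ler_pM ?(C_norm_ge0 cK)//.
  + by apply: prodr_ge0 => w _; exact: (C_norm_ge0 cK).
  + by apply: C_norm_le => t; rewrite C_ofE.
  + rewrite big_seq; apply: prodr_ile1 => w; rewrite mem_nseq => /andP[_ /eqP ->].
    rewrite (C_norm_ge0 cK)/=; apply: C_norm_le => t.
    by rewrite C_ofE// normr1.
exists mu => x; rewrite PF (power_form x c0 symF oF) /power_integral muE//.
by have cx := @cts_fun _ _ x; cts.
Qed.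

End orthogonally_additive_representation.

(** * Integration against a charge and approximation of its positive set *)

Section sum_of_finite_measures.
Context d (T : measurableType d) (R : realType).
Variables m1 m2 : {finite_measure set T -> \bar R}.

Definition finite_add (A : set T) : \bar R := (m1 A + m2 A)%E.

Let finite_add0 : finite_add set0 = 0%E.
Proof. by rewrite /finite_add !measure0 adde0. Qed.

Let finite_add_ge0 A : (0 <= finite_add A)%E.
Proof. exact: adde_ge0. Qed.

Let finite_add_sigma : semi_sigma_additive finite_add.
Proof.
move=> F mF tF mUF; under eq_fun do rewrite big_split; apply: cvgeD => //=.
- by rewrite ge0_adde_def// inE.
- exact: measure_semi_sigma_additive.
- exact: measure_semi_sigma_additive.
Qed.

HB.instance Definition _ := isMeasure.Build _ _ _ finite_add
  finite_add0 finite_add_ge0 finite_add_sigma.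

Let finite_add_fin : fin_num_fun finite_add.
Proof. by move=> A mA; rewrite fin_numD !fin_num_measure. Qed.

HB.instance Definition _ := Measure_isFinite.Build _ _ _ finite_add finite_add_fin.

End sum_of_finite_measures.

Section zero_finite_measure.
Context d (T : measurableType d) (R : realType).

Let mzero_fin : fin_num_fun (@mzero d T R).
Proof. by []. Qed.

HB.instance Definition _ := Measure_isFinite.Build _ _ _ (@mzero d T R) mzero_fin.
End zero_finite_measure.

Section charge_integral_theory.
Context {R : realType} {K : ptopologicalType}.
Hypotheses (cK : compact [set: K]) (hK : hausdorff_space K).
Implicit Types (mu nu : {charge set (borel K) -> \bar R}) (f g : K -> R) (e : R).

Lemma charge_integral_add mu nu (la : {charge set (borel K) -> \bar R}) f : continuous f ->
  (forall A, measurable A -> la A = (mu A + nu A)%E) ->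
  charge_integral la f = charge_integral mu f + charge_integral nu f.
Proof.
move=> cf laE.
rewrite (charge_integralE cK (m1 := finite_add (charge_pos mu) (charge_pos nu))
  (m2 := finite_add (charge_neg mu) (charge_neg nu)))//; last first.
  move=> A mA; rewrite laE// (charge_jordan mu mA) (charge_jordan nu mA).
  suff : (charge_pos mu A - charge_neg mu A + (charge_pos nu A - charge_neg nu A) =
      (charge_pos mu A + charge_pos nu A) - (charge_neg mu A + charge_neg nu A))%E.
    by [].
  have f1 : charge_pos mu A \is a fin_num by exact: fin_num_measure.
  have f2 : charge_neg mu A \is a fin_num by exact: fin_num_measure.
  have f3 : charge_pos nu A \is a fin_num by exact: fin_num_measure.
  have f4 : charge_neg nu A \is a fin_num by exact: fin_num_measure.
  rewrite -(fineK f1) -(fineK f2) -(fineK f3) -(fineK f4).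
  by rewrite -!(EFinB, EFinD); congr (_%:E); ring.
rewrite (Rint_measure_add cK cf (m := finite_add (charge_pos mu) (charge_pos nu))
  (m1 := charge_pos mu) (m2 := charge_pos nu))//.
rewrite (Rint_measure_add cK cf (m := finite_add (charge_neg mu) (charge_neg nu))
  (m1 := charge_neg mu) (m2 := charge_neg nu))//.
by rewrite /charge_integral; ring.
Qed.

Lemma Rint_mscale (a : {nonneg R}) (m : {finite_measure set (borel K) -> \bar R}) f :
  continuous f -> \int[mscale a m]_t f t = a%:num * \int[m]_t f t.
Proof.
move=> cf.
have nonneg g : nonneg_cts g -> \int[mscale a m]_t g t = a%:num * \int[m]_t g t.
  move=> [cg g0]; rewrite /Rintegral ge0_integral_mscale//.
  - by rewrite fineM//; apply: integrable_fin_num => //; exact: cts_integrable.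
  - by apply/measurable_realfun.measurable_EFinP; exact: cts_measurable.
  - by move=> t _; rewrite lee_fin.
have [fp [fn [nfp nfn fE]]] := cts_pos_neg cf.
have [[cfp _] [cfn _]] := (nfp, nfn).
have cmfn : continuous (fun t => -1 * fn t) by cts.
by rewrite fE !RintD// !RintZ// !nonneg//; ring.
Qed.

Lemma charge_integral_opp mu (la : {charge set (borel K) -> \bar R}) f : continuous f ->
  (forall A, measurable A -> la A = (- mu A)%E) ->
  charge_integral la f = - charge_integral mu f.
Proof.
move=> cf laE; rewrite (charge_integralE cK (m1 := charge_neg mu) (m2 := charge_pos mu))//.
  by rewrite /charge_integral; ring.
by move=> A mA; rewrite laE// (charge_jordan mu mA) fin_num_oppeB ?fin_num_measure// addeC.
Qed.

Lemma charge_integral_scale a mu (la : {charge set (borel K) -> \bar R}) f : continuous f ->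
  (forall A, measurable A -> la A = (a%:E * mu A)%E) ->
  charge_integral la f = a * charge_integral mu f.
Proof.
move=> cf; wlog a0 : a la / 0 <= a => [pos_case laE|laE].
  have [a0|/ltW a0] := leP 0 a; first exact: pos_case.
  have := charge_integral_opp cf (la := la) (mu := copp la).
  rewrite (pos_case (- a) (copp la)) ?oppr_ge0//.
    by rewrite mulNr opprK; apply => A mA; rewrite -[X in (- X)%E]/(- la A)%E oppeK.
  by move=> A mA; rewrite -[LHS]/(- la A)%E laE// EFinN mulNe.
rewrite (charge_integralE cK (m1 := mscale (NngNum a0) (charge_pos mu))
  (m2 := mscale (NngNum a0) (charge_neg mu)))// ?Rint_mscale//.
  by rewrite /charge_integral/=; ring.
move=> A mA; rewrite laE// (charge_jordan mu mA) /mscale/= muleBr//.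
by rewrite fin_num_adde_defr// fin_num_measure.
Qed.

Lemma charge_integral_ge0 mu f : (forall A, measurable A -> (0 <= mu A)%E) ->
  nonneg_cts f -> 0 <= charge_integral mu f.
Proof.
move=> mu0 [cf f0]; have neg0 A : measurable A -> charge_neg mu A = 0%E.
  move=> mA; apply/eqP; rewrite eq_le measure_ge0 andbT charge_negE//.
  rewrite leeNl oppe0; apply: mu0; apply: measurableI => //.
  by have [_ [mN _] _ _] := svalP (hahn mu).
rewrite /charge_integral [X in _ - X](_ : _ = 0) ?subr0; first exact: Rint_ge0.
rewrite /Rintegral (eq_measure_integral mzero) ?integral_measure_zero//.
by move=> A mA _; exact: (neg0 A mA).
Qed.

(** Urysohn functions for closed sets inside and open sets around the positive
    set of mu approximate its indicator in the mean, by regularity. *)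
Lemma positive_set_approx mu e : regular mu -> 0 < e -> exists h : K -> R,
  [/\ continuous h, forall t, 0 <= h t <= 1,
    \int[charge_pos mu]_t (1 - h t) <= e & \int[charge_neg mu]_t h t <= e].
Proof.
move=> rmu e0; have [[mP _] [mN _] PN PN0] := svalP (hahn mu).
have [D [U [cD oU DP PU ltUD]]] := rmu _ mP e e0.
have [h [ch h01 h0 h1]] : exists h : K -> R, [/\ continuous h,
    forall t, 0 <= h t <= 1, forall t, (~` U) t -> h t = 0 & forall t, D t -> h t = 1].
  apply: urysohn => //; first exact: open_closedC.
  by apply/seteqP; split => // t [/= nUt Dt]; exact/nUt/PU/DP.
have mU : measurable (U : set (borel K)) by exact: open_borel.
have mD : measurable (D : set (borel K)) by exact: closed_borel.
have mUD : measurable (U `\` D : set (borel K)) by exact: measurableD.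
have small (A : set (borel K)) : measurable A -> A `<=` U `\` D -> (`|mu A| <= e%:E)%E.
  move=> mA AUD; apply: le_trans (abse_charge_variation (svalP (hahn mu)) mA) _.
  apply: le_trans (ltW ltUD); apply: (le_measure (charge_abs mu)); rewrite ?inE//.
exists h; split => //.
  apply: le_trans (Rint_le_measure cK (charge_pos mu) _ (measurableC mD) _ _) _.
  - by cts.
  - by move=> t; have /andP[? _] := h01 t; lra.
  - by move=> t /contrapT Dt; rewrite h1// subrr.
  rewrite -lee_fin fineK ?fin_num_measure//; last exact: measurableC.
  rewrite charge_posE; last exact: measurableC.
  apply: le_trans (lee_abs _) (small _ _ _).
    by apply: measurableI => //; exact: measurableC.
  by move=> t [nDt /PU Ut].
apply: le_trans (Rint_le_measure cK (charge_neg mu) ch mU _ _) _.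
- by move=> t; have /andP[] := h01 t.
- by move=> t nUt; rewrite h0.
rewrite -lee_fin fineK ?fin_num_measure// charge_negE//.
apply: le_trans (lee_abs _) _; rewrite abseN; apply: small; first exact: measurableI.
move=> t [Ut Nt]; split => // Dt.
by have : set0 t by rewrite -PN0; split => //; exact: DP.
Qed.

(** Tested on 1 - h, with h close to the indicator of the positive set, the
    integral is close to minus the mass of the negative part. *)
Lemma charge_ge0_of_integral mu : regular mu ->
  (forall f, nonneg_cts f -> 0 <= charge_integral mu f) ->
  forall A, measurable A -> (0 <= mu A)%E.
Proof.
move=> rmu int0; have fT : charge_neg mu setT \is a fin_num by exact: fin_num_measure.
have neg0 : fine (charge_neg mu setT) <= 0.
  apply/ler_addgt0Pr => e e0; rewrite add0r.
  have e20 : 0 < e / 2 by rewrite divr_gt0.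
  have [h [ch h01 hpos hneg]] := positive_set_approx rmu e20.
  have n1h : nonneg_cts (fun t => 1 - h t).
    by split => [|t]; [cts|have /andP[_ ?] := h01 t; rewrite subr_ge0].
  have := int0 _ n1h; rewrite /charge_integral.
  rewrite (Rint_cstB cK (charge_neg mu))// mul1r.
  lra.
move=> A mA; rewrite (charge_jordan mu mA) sube_ge0 ?fin_num_measure ?orbT//.
apply: le_trans (_ : 0%E <= _)%E => //.
apply: le_trans (_ : charge_neg mu A <= charge_neg mu setT)%E _.
  by apply: (le_measure (charge_neg mu)); rewrite ?inE.
by rewrite -(fineK fT) lee_fin.
Qed.

(** The function 2 h - 1, with h close to the indicator of the positive set, is
    close to the sign of mu. *)
Lemma variation_approx mu f e : regular mu -> nonneg_cts f -> 0 < e ->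
  exists h : K -> R, [/\ continuous h, forall t, `|h t| <= 1 &
    \int[charge_pos mu]_t f t + \int[charge_neg mu]_t f t - e <=
    charge_integral mu (fun t => f t * h t)].
Proof.
move=> rmu [cf f0] e0; have [c fc] := cts_bounded cK cf.
have c0 : 0 <= c by exact: le_trans (fc point).
pose e' := e / (4%:R * (c + 1)).
have c10 : 0 < c + 1 by rewrite ltr_wpDl.
have e'0 : 0 < e' by rewrite divr_gt0// mulr_gt0.
have e'E : 4%:R * (c + 1) * e' = e by rewrite /e'; field; rewrite gt_eqF.
have [h [ch h01 hpos hneg]] := positive_set_approx rmu e'0.
exists (fun t => 2 * h t - 1); split; first by cts.
  by move=> t; have /andP[? ?] := h01 t; rewrite ler_norml; lra.
have c1h : continuous (fun t => 1 - h t) by cts.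
have cfh : continuous (fun t => f t * h t) by cts.
have cf1h : continuous (fun t => f t * (1 - h t)) by cts.
have fc' t : f t <= c by exact: le_trans (ler_norm _) (fc t).
have ipos : \int[charge_pos mu]_t (f t * (1 - h t)) <= c * e'.
  apply: (@le_trans _ _ (\int[charge_pos mu]_t (c * (1 - h t)))).
    apply: Rint_le => //; [by cts|move=> t].
    by have /andP[? ?] := h01 t; rewrite ler_wpM2r// subr_ge0.
  by rewrite RintZ// ler_wpM2l.
have ineg : \int[charge_neg mu]_t (f t * h t) <= c * e'.
  apply: (@le_trans _ _ (\int[charge_neg mu]_t (c * h t))).
    by apply: Rint_le => //; [cts|move=> t; have /andP[? ?] := h01 t; rewrite ler_wpM2r].
  by rewrite RintZ// ler_wpM2l.
rewrite /charge_integral.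
have c2 : continuous (fun t => (-2) * (f t * (1 - h t))) by cts.
have c3 : continuous (fun t => 2 * (f t * h t)) by cts.
have c4 : continuous (fun t => -1 * f t) by cts.
have -> : \int[charge_pos mu]_t (f t * (2 * h t - 1)) =
    \int[charge_pos mu]_t f t - 2 * \int[charge_pos mu]_t (f t * (1 - h t)).
  by rewrite -mulNr -RintZ// -RintD//; apply: eq_Rintegral => t _; ring.
have -> : \int[charge_neg mu]_t (f t * (2 * h t - 1)) =
    2 * \int[charge_neg mu]_t (f t * h t) - \int[charge_neg mu]_t f t.
  by rewrite -[- Rintegral _ _ _]mulN1r -(RintZ cK _ 2)// -(RintZ cK _ (-1))// -RintD//;
    apply: eq_Rintegral => t _; ring.
lra.
Qed.

Lemma positive_part_approx mu e : regular mu -> 0 < e ->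
  exists h : K -> R, [/\ continuous h, forall t, 0 <= h t <= 1 &
    fine (charge_pos mu setT) - e <= charge_integral mu h].
Proof.
move=> rmu e0; have e20 : 0 < e / 2 by rewrite divr_gt0.
have [h [ch h01 hpos hneg]] := positive_set_approx rmu e20.
exists h; split => //; move: hpos.
rewrite (Rint_cstB cK (charge_pos mu))// mul1r.
by rewrite /charge_integral; lra.
Qed.

Lemma negative_part_approx mu e : regular mu -> 0 < e ->
  exists h : K -> R, [/\ continuous h, forall t, 0 <= h t <= 1 &
    fine (charge_neg mu setT) - e <= - charge_integral mu h].
Proof.
move=> rmu e0; have e20 : 0 < e / 2 by rewrite divr_gt0.
have [h [ch h01 hpos hneg]] := positive_set_approx rmu e20.
have c1h : continuous (fun t => 1 - h t) by cts.
exists (fun t => 1 - h t); split => //.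
  by move=> t; have /andP[? ?] := h01 t; lra.
rewrite /charge_integral.
rewrite (Rint_cstB cK (charge_neg mu))// mul1r.
by lra.
Qed.

Lemma charge_integral_le_variation mu f c : continuous f -> (forall t, `|f t| <= c) ->
  `|charge_integral mu f| <= tv_norm mu * c.
Proof.
move=> cf fc; rewrite /charge_integral.
have cnf : continuous (fun t => `|f t|) by cts.
have le_c (la : {finite_measure set (borel K) -> \bar R}) :
    `|\int[la]_t f t| <= c * fine (la setT).
  rewrite -Rint_cst; have cc := @cts_cst R K c; rewrite ler_norml; apply/andP; split.
    rewrite -mulN1r -RintZ//; apply: Rint_le => //; first by cts.
    by move=> t; have := fc t; rewrite ler_norml; lra.
  by apply: Rint_le => // t; exact: le_trans (ler_norm _) (fc t).
apply: le_trans (ler_normB _ _) _; apply: le_trans (lerD (le_c _) (le_c _)) _.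
rewrite -mulrDr mulrC /tv_norm charge_absE fineD// fin_num_measure//.
Qed.

End charge_integral_theory.

(** * The Banach lattice of regular measures *)

Section ordered_spaces.
Context {R : realType}.
Implicit Types E F : lmodType R.

Section translation_invariant.
Context {E : lmodType R} (le : E -> E -> Prop).
Hypothesis le_add : forall x y z, le x y -> le (x + z) (y + z).

Lemma join_translate x y z s : is_join le x y s -> is_join le (x + z) (y + z) (s + z).
Proof.
case=> xs ys s_min; split; [exact: le_add|exact: le_add|] => w xw yw.
rewrite -[w](subrK z); apply: le_add; apply: s_min.
  by rewrite -[x](addrK z); exact: le_add.
by rewrite -[y](addrK z); exact: le_add.
Qed.

(** In a vector lattice the join and the meet of x and y add up to x + y. *)
Lemma meet_of_join x y s : is_join le x y s -> is_meet le x y (x + y - s).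
Proof.
case=> xs ys s_min.
have swap a b c : le b c -> le (a + b - c) a.
  move=> /(le_add (a - c)); rewrite addrCA [c + _]addrC subrK addrA.
  by rewrite -[X in le X _]addrA [b - c]addrC addrA.
split; first exact: swap.
  by rewrite [x + y]addrC; exact: swap.
move=> z zx zy; have : le s (x + y - z).
  apply: s_min.
    by move: (le_add (x - z) zy); rewrite addrCA subrr addr0 [y + _]addrC addrAC.
  by move: (le_add (y - z) zx); rewrite addrCA subrr addr0 addrA.
by move=> /(le_add (z - s)); rewrite addrCA subrr addr0 addrA subrK.
Qed.

End translation_invariant.

(** This reduces the claim about polynomials to the Banach lattice of measures and to
    the effect of J on order and norms. *)
Lemma banach_lattice_transfer E F (leE : E -> E -> Prop) (NE : E -> R)
    (leF : F -> F -> Prop) (NF : F -> R) (T : E -> F) :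
  banach_lattice leE NE -> linear T -> bijective T ->
  (forall x y, leF (T x) (T y) <-> leE x y) -> (forall x, NF (T x) = NE x) ->
  banach_lattice_isometric_isomorphism leE NE leF NF T.
Proof.
move=> blE linT bijT leT NT; have [g TK gK] := bijT.
have [[lrefl lanti ltrans ladd lscale ljoin lmeet] [N0 Neq0 NZ ND] lmono lcompl] := blE.
have TD x y : T (x + y) = T x + T y by have := linT 1 x y; rewrite !scale1r.
have T0 : T 0 = 0 by have := linT (-1) 0 0; rewrite !scaleN1r addNr => ->; rewrite addNr.
have TZ a x : T (a *: x) = a *: T x by have := linT a x 0; rewrite T0 !addr0.
have TN x : T (- x) = - T x by have := TZ (-1) x; rewrite !scaleN1r.
have joinT x y s : is_join leF (T x) (T y) (T s) <-> is_join leE x y s.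
  split=> -[xs ys s_min]; split; rewrite ?leT//; try exact/leT.
    by move=> z xz yz; apply/leT; apply: s_min; exact/leT.
  by move=> z; rewrite -(gK z) !leT; exact: s_min.
have meetT x y s : is_meet leF (T x) (T y) (T s) <-> is_meet leE x y s.
  split=> -[sx sy s_max]; split; rewrite ?leT//; try exact/leT.
    by move=> z zx zy; apply/leT; apply: s_max; exact/leT.
  by move=> z; rewrite -(gK z) !leT; exact: s_max.
have normF : is_norm NF.
  split=> [y|y|a y|y z].
  - by rewrite -(gK y) NT.
  - by rewrite -(gK y) NT => /Neq0 ->.
  - by rewrite -(gK y) -TZ !NT.
  - by rewrite -(gK y) -(gK z) -TD !NT.
split => //.
- split => //; first split.
  + by move=> x; rewrite -(gK x); apply/leT.
  + by move=> x y; rewrite -(gK x) -(gK y) !leT => xy yx; rewrite (lanti _ _ xy yx).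
  + by move=> x y z; rewrite -(gK x) -(gK y) -(gK z) !leT; exact: ltrans.
  + by move=> x y z; rewrite -(gK x) -(gK y) -(gK z) -!TD !leT; exact: ladd.
  + by move=> a x y a0; rewrite -(gK x) -(gK y) -!TZ !leT; exact: lscale.
  + move=> x y; have [s sP] := ljoin (g x) (g y); exists (T s).
    by rewrite -(gK x) -(gK y); apply/joinT.
  + move=> x y; have [s sP] := lmeet (g x) (g y); exists (T s).
    by rewrite -(gK x) -(gK y); apply/meetT.
  + move=> x y x' y'; rewrite -(gK x) -(gK y) -(gK x') -(gK y') -!TN !joinT leT !NT.
    exact: lmono.
  + move=> u cauchy; have [|l lP] := lcompl (fun i => g (u i)).
      move=> e /cauchy[m mP]; exists m => i j im jm.
      by rewrite -NT TD TN !gK mP.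
    exists (T l) => e /lP[m mP]; exists m => i im.
    by rewrite -(gK (u i)) -TN -TD NT mP.
- by split=> x y s; [move/joinT|move/meetT].
Qed.

End ordered_spaces.

Section measure_lattice.
Context {R : realType} {K : ptopologicalType}.
Hypotheses (cK : compact [set: K]) (hK : hausdorff_space K).
Local Notation M := (regular_measure R K).
Implicit Types (mu nu : M) (A : set (borel K)).

Let pos_regular mu : regular (charge_of_finite_measure (charge_pos mu)).
Proof.
apply: (@regular_dominated _ _ _ mu mu 1%:nng); [exact: rm_regular..|] => A mA.
rewrite mul1e [X in `|X|%E]/(charge_pos mu A) gee0_abs//.
by apply: (le_trans (leeDl _ _) (leeDl _ _)).
Qed.

Let neg_regular mu : regular (charge_of_finite_measure (charge_neg mu)).
Proof.
apply: (@regular_dominated _ _ _ mu mu 1%:nng); [exact: rm_regular..|] => A mA.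
rewrite mul1e [X in `|X|%E]/(charge_neg mu A) gee0_abs//.
by apply: (le_trans (leeDr _ _) (leeDl _ _)).
Qed.

Let pos_off mu A : ~ measurable A -> charge_of_finite_measure (charge_pos mu) A = 0%E.
Proof.
by move=> nmA; rewrite /charge_of_finite_measure /charge_pos/= jordan_posE cjordan_posE
  /crestr0 memNset.
Qed.

Let neg_off mu A : ~ measurable A -> charge_of_finite_measure (charge_neg mu) A = 0%E.
Proof.
move=> nmA; rewrite /charge_of_finite_measure /charge_neg/= jordan_negE cjordan_negE.
by rewrite /crestr0 memNset// oppe0.
Qed.

Definition M_pos mu : M := RegularMeasure (pos_regular mu) (@pos_off mu).
Definition M_neg mu : M := RegularMeasure (neg_regular mu) (@neg_off mu).
Definition M_abs mu : M := M_pos mu + M_neg mu.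

Lemma regular_measure_eq mu nu : (forall A, measurable A -> mu A = nu A) -> mu = nu.
Proof.
move=> munu; apply: regular_measureP => A.
have [/munu//|nmA] := pselect (measurable A).
by rewrite !rm_off_borel.
Qed.

Lemma M_absE mu A : M_abs mu A = charge_abs mu A.
Proof. by []. Qed.

Lemma measure_le_add mu nu la : measure_le mu nu -> measure_le (mu + la) (nu + la).
Proof. by move=> munu A mA; exact: leeD2r (munu A mA). Qed.

Lemma measure_le_anti mu nu : measure_le mu nu -> measure_le nu mu -> mu = nu.
Proof.
move=> munu numu; apply: regular_measure_eq => A mA.
by apply/eqP; rewrite eq_le munu// numu.
Qed.

(** A majorant of mu and 0 dominates on A what mu does on the part of A in the
    positive set, and this is the positive part of mu. *)
Lemma join_pos mu : is_join (@measure_le R K) mu 0 (M_pos mu).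
Proof.
split=> [A mA|A mA|nu munu nu0 A mA].
- rewrite (charge_jordan mu mA) -[X in (_ <= X)%E]/(charge_pos mu A).
  by rewrite leeBlDr ?leeDl// fin_num_measure.
- exact: (measure_ge0 (charge_pos mu)).
- have [[mP _] _ _ _] := svalP (hahn mu).
  rewrite -[X in (X <= _)%E]/(charge_pos mu A) charge_posE//.
  have mAP := measurableI _ _ mA mP; apply: le_trans (munu _ mAP) _.
  rewrite (chargeDI nu mA mP) leeDr//; exact: (nu0 _ (measurableD mA mP)).
Qed.

Lemma join_abs mu : is_join (@measure_le R K) mu (- mu) (M_abs mu).
Proof.
split=> [A mA|A mA|nu munu nmunu A mA].
- by apply: le_trans (lee_abs _) (abse_charge_variation _ mA).
- apply: le_trans (lee_abs _) _; rewrite -[X in `|X|%E]/(- mu A)%E abseN.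
  exact: abse_charge_variation.
- have le_abs (B : set (borel K)) : measurable B -> (`|mu B| <= nu B)%E.
    move=> mB; have [m0|/ltW m0] := leP 0%E (mu B).
      by rewrite gee0_abs//; exact: munu.
    by rewrite lee0_abs//; exact: nmunu.
  have nu0 (B : set (borel K)) : measurable B -> (0 <= nu B)%E.
    by move=> mB; apply: le_trans (le_abs B mB).
  rewrite M_absE -(charge_abs_nonneg nu0)//; apply: charge_abs_min => // B mB.
  by rewrite charge_abs_nonneg//; exact: le_abs.
Qed.

Lemma measure_vector_lattice : vector_lattice (@measure_le R K).
Proof.
have joins mu nu : is_join (@measure_le R K) mu nu (M_pos (mu - nu) + nu).
  have := join_translate (@measure_le_add) nu (join_pos (mu - nu)).
  by rewrite subrK add0r.
split=> [mu A mA|||||mu nu|mu nu].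
- exact: lexx.
- exact: measure_le_anti.
- by move=> mu nu la munu nula A mA; exact: le_trans (munu A mA) (nula A mA).
- exact: measure_le_add.
- by move=> a mu nu a0 munu A mA; apply: lee_wpmul2l (munu A mA); rewrite lee_fin.
- by exists (M_pos (mu - nu) + nu).
- by exists (mu + nu - (M_pos (mu - nu) + nu)); exact: meet_of_join (@measure_le_add) _ _
  _ (joins _ _).
Qed.

Lemma M_integralD (a : R) mu nu f : continuous f ->
  charge_integral (a *: mu + nu) f = a * charge_integral mu f + charge_integral nu f.
Proof.
move=> cf; rewrite (charge_integral_add cK (mu := a *: mu) (nu := nu))//.
by rewrite (charge_integral_scale cK (a := a) (mu := mu)).
Qed.

Lemma M_integralB mu nu f : continuous f ->
  charge_integral (mu - nu) f = charge_integral mu f - charge_integral nu f.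
Proof.
by move=> cf; rewrite addrC -scaleN1r M_integralD//; ring.
Qed.

Lemma M_pos_integral mu f : continuous f ->
  charge_integral (M_pos mu) f = \int[charge_pos mu]_t f t.
Proof.
move=> cf; rewrite (charge_integralE cK (m1 := charge_pos mu) (m2 := mzero))//.
  by rewrite /Rintegral integral_measure_zero subr0.
by move=> A mA; rewrite sube0.
Qed.

Lemma M_neg_integral mu f : continuous f ->
  charge_integral (M_neg mu) f = \int[charge_neg mu]_t f t.
Proof.
move=> cf; rewrite (charge_integralE cK (m1 := charge_neg mu) (m2 := mzero))//.
  by rewrite /Rintegral integral_measure_zero subr0.
by move=> A mA; rewrite sube0.
Qed.

Lemma M_abs_integral mu f : continuous f ->
  charge_integral (M_abs mu) f = \int[charge_pos mu]_t f t + \int[charge_neg mu]_t f t.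
Proof.
move=> cf; rewrite /M_abs -[M_pos mu]scale1r M_integralD// mul1r.
by rewrite M_pos_integral// M_neg_integral.
Qed.

(** The order of measures is the order of the functionals they define, which is
    what makes J an order isomorphism. *)
Lemma measure_le_integral mu nu : measure_le mu nu <->
  forall f, nonneg_cts f -> charge_integral mu f <= charge_integral nu f.
Proof.
split=> [munu f nf|le_int A mA].
  have [cf f0] := nf; rewrite -subr_ge0 -M_integralB//;
    apply: charge_integral_ge0 => // A mA.
  by rewrite -[(nu - mu) A]/(nu A - mu A)%E sube_ge0 ?munu// regular_measure_fin.
have : (0 <= (nu - mu)%R A)%E.
  apply: (charge_ge0_of_integral cK hK) => //; first exact: rm_regular.
  by move=> f nf; have [cf _] := nf; rewrite M_integralB// subr_ge0 le_int.
by rewrite -[(nu - mu) A]/(nu A - mu A)%E sube_ge0// regular_measure_fin.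
Qed.

Lemma tv_normE mu : tv_norm mu = fine (charge_pos mu setT) + fine (charge_neg mu setT).
Proof. by rewrite /tv_norm charge_absE fineD// fin_num_measure. Qed.

Lemma tv_norm_ge0 mu : 0 <= tv_norm mu.
Proof. by rewrite /tv_norm fine_ge0. Qed.

Lemma tv_norm_abs mu : tv_norm (M_abs mu) = tv_norm mu.
Proof.
rewrite /tv_norm; congr fine; apply: (charge_abs_nonneg (mu := M_abs mu)) => // A mA.
exact: (measure_ge0 (charge_abs mu)).
Qed.

Lemma tv_norm_le mu c : (forall f, continuous f -> (forall t, `|f t| <= 1) ->
  `|charge_integral mu f| <= c) -> tv_norm mu <= c.
Proof.
move=> le_c; apply/ler_addgt0Pr => e e0.
have n1 : nonneg_cts (fun _ : K => 1 : R) by split => //; cts.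
have [h [ch h1 le_h]] := variation_approx cK hK (rm_regular mu) n1 e0.
have := le_c h ch h1; rewrite ler_norml => /andP[_].
move: le_h; rewrite !Rint_cst !mul1r tv_normE.
rewrite (_ : (fun t => 1 * h t) = h); first lra.
by apply/funext => t; rewrite mul1r.
Qed.

(** Cauchy sequences of measures converge weakly as functionals; the limit
    functional is a measure by Riesz representation. *)
Lemma tv_norm_complete : norm_complete (fun mu : M => tv_norm mu).
Proof.
move=> u cauchy; pose I f i := charge_integral (u i) f.
have I_close f c i j : continuous f -> (forall t, `|f t| <= c) ->
    `|I f i - I f j| <= tv_norm (u i - u j) * c.
  by move=> cf fc; rewrite /I -M_integralB//; exact: charge_integral_le_variation.
have I_cvg f : continuous f -> cvgn (I f).
  move=> cf; have [c fc] := cts_bounded cK cf.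
  have c0 : 0 <= c by exact: le_trans (fc point).
  have c10 : 0 < c + 1 by rewrite ltr_wpDl.
  apply/cauchy_cvgP; apply: cauchy_exP => e e0.
  have [m mP] := cauchy (e / (c + 1)) (divr_gt0 e0 c10).
  exists (I f m); exists m => // i /= mi.
  apply: le_lt_trans (I_close f c m i cf fc) _.
  have lt_e := mP m i (leqnn m) mi.
  apply: (@le_lt_trans _ _ (tv_norm (u m - u i) * (c + 1))).
    by rewrite ler_wpM2l ?tv_norm_ge0// lerDl.
  by rewrite -ltr_pdivlMr.
pose L f := limn (I f).
have I_to_L f e : continuous f -> 0 < e -> exists m, forall i, (m <= i)%N ->
  `|L f - I f i| < e.
  move=> cf e0; have /cvgrPdist_lt/(_ e e0)[m _ mP] : I f @ \oo --> L f by exact: I_cvg.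
  by exists m => i /mP.
have L_close f i e : 0 < e -> continuous f -> (forall t, `|f t| <= 1) ->
    (forall j, (i <= j)%N -> tv_norm (u i - u j) <= e) -> `|I f i - L f| <= e.
  move=> e0 cf f1 le_e; apply/ler_addgt0Pr => d d0; have [m mP] := I_to_L f d cf d0.
  have := mP (maxn m i) (leq_maxl _ _); have := le_e (maxn m i) (leq_maxr _ _).
  have := I_close f 1 i (maxn m i) cf f1; rewrite mulr1 => h1 h2 h3.
  have -> : I f i - L f = (I f i - I f (maxn m i)) + (I f (maxn m i) - L f) by ring.
  apply: le_trans (ler_normD _ _) _; rewrite [X in _ + X]distrC.
  by apply: lerD; [exact: le_trans h1 h2|exact: ltW].
have [m1 m1P] := cauchy 1 ltr01.
have [||mu muE] := riesz_representation cK hK (L := L) (M := tv_norm (u m1) + 1).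
- move=> a f g cf cg; apply: cvg_lim => //.
  rewrite (_ : I _ = fun i => a * I f i + I g i); last first.
    by apply/funext => i; exact: (charge_integralD cK).
  by apply: cvgD; [apply: cvgM; [exact: cvg_cst|exact: I_cvg]|exact: I_cvg].
- move=> f c cf fc; apply/ler_addgt0Pr => e e0.
  have c0 : 0 <= c by exact: le_trans (fc point).
  have [m mP] := I_to_L f e cf e0.
  have := mP (maxn m m1) (leq_maxl _ _).
  have lt1 := m1P (maxn m m1) m1 (leq_maxr _ _) (leqnn _).
  have h1 := I_close f c (maxn m m1) m1 cf fc.
  have h2 : `|I f m1| <= tv_norm (u m1) * c by exact: charge_integral_le_variation.
  have := ler_wpM2r c0 (ltW lt1); rewrite mul1r => h3 h4.
  have -> : L f = (L f - I f (maxn m m1)) + ((I f (maxn m m1) - I f m1) + I f m1) by ring.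
  apply: le_trans (ler_normD _ _) _; apply: le_trans (lerD (ltW h4) (ler_normD _ _)) _.
  by rewrite mulrDl mul1r; lra.
exists mu => e e0; have e20 : 0 < e / 2 by rewrite divr_gt0.
have [m mP] := cauchy _ e20; exists m => i im.
apply: (@le_lt_trans _ _ (e / 2)); last by rewrite ltr_pdivrMr// ltr_pMr// ltr1n.
apply: tv_norm_le => f cf f1; rewrite M_integralB// muE//.
by apply: L_close => // j ij; apply: ltW; apply: mP => //; exact: leq_trans im ij.
Qed.

End measure_lattice.

(** * Order and absolute values of power integrals *)

Section uniqueness_of_forms.
Context {R : realType} {K : ptopologicalType}.
Hypothesis cK : compact [set: K].
Local Notation C := (continuousType K R).
Implicit Types (F G : seq C -> R) (x y u : C) (r s : seq C).

Lemma sym_form_sub F G c d : sym_form F c -> sym_form G d ->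
  sym_form (fun s => F s - G s) (c + d).
Proof.
move=> symF symG; split=> [a y z s|s t st|s].
- by rewrite (sf_lin symF) (sf_lin symG); ring.
- by rewrite (sf_perm symF st) (sf_perm symG st).
- apply: le_trans (ler_normB _ _) _; rewrite mulrDl; apply: lerD.
    exact: sf_bound symF s.
  exact: sf_bound symG s.
Qed.

Lemma polarization F c m r : sym_form F c -> (forall x, F (nseq m x ++ r) = 0) ->
  forall s, size s = m -> F (s ++ r) = 0.
Proof.
move=> symF; elim: m r => [|m IHm] r F0 s; first by move=> /size0nil ->; exact: (F0 0).
case: s => // u s [sm].
have -> : F ((u :: s) ++ r) = F (s ++ u :: r).
  by apply: (sf_perm symF); rewrite perm_sym; exact: perm_middle.
apply: IHm => // x.
have -> : F (nseq m x ++ u :: r) = F (u :: nseq m x ++ r).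
  by apply: (sf_perm symF); exact: perm_middle.
by apply: (form_line_zero symF) => a; exact: F0.
Qed.

Lemma form_of_unique n P (A B : ('I_n -> C) -> R) : form_of P A -> form_of P B -> A = B.
Proof.
move=> fA fB; have [mA bA sA _] := fA; have [mB bB sB _] := fB.
have [c _ symA] := seq_form_sym cK mA bA sA.
have [d _ symB] := seq_form_sym cK mB bB sB.
apply/funext => x; apply/eqP; rewrite -subr_eq0; apply/eqP.
have := @polarization _ _ n [::] (sym_form_sub symA symB) _ [seq x i | i <- enum 'I_n].
rewrite cats0 size_map size_enum_ord => <- //.
  rewrite /seq_form size_map size_enum_ord eqxx; congr (A _ - B _).
    by apply/funext => i; rewrite (nth_map i) ?size_enum_ord// nth_ord_enum.
  by apply/funext => i; rewrite (nth_map i) ?size_enum_ord// nth_ord_enum.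
by move=> y; rewrite cats0 -(form_of_seq fA) -(form_of_seq fB) subrr.
Qed.

(** Polynomials that agree on the positive cone agree everywhere: along the line
    from x^+ in the direction x^- both are polynomials in one real variable. *)
Lemma poly_le_anti n (P Q : C -> R) : poly_le n P Q -> poly_le n Q P -> P = Q.
Proof.
move=> [A [B [fA fB AB]]] [B' [A' [fB' fA' BA]]].
have PQ x : (forall t, 0 <= x t) -> P x = Q x.
  move=> x0; have [_ _ _ PA] := fA; have [_ _ _ QB] := fB.
  have [_ _ _ QB'] := fB'; have [_ _ _ PA'] := fA'.
  apply/eqP; rewrite eq_le; apply/andP; split.
    by rewrite PA QB; apply: AB.
  by rewrite PA' QB'; apply: BA.
have [mA bA sA _] := fA; have [mB bB sB _] := fB.
have [c _ symA] := seq_form_sym cK mA bA sA.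
have [d _ symB] := seq_form_sym cK mB bB sB.
apply/funext => x; have cx := @cts_fun _ _ x.
pose u := C_of (fun t => Num.max (x t) 0); pose v := C_of (fun t => Num.max (- x t) 0).
have uE t : u t = Num.max (x t) 0 by rewrite C_ofE//; cts.
have vE t : v t = Num.max (- x t) 0 by rewrite C_ofE//; cts.
have [p [pE _]] := form_along_line symA n u v [::].
have [q [qE _]] := form_along_line symB n u v [::].
have PE a : P (u + a *: v) = p.[a] by rewrite (form_of_seq fA) -pE cats0.
have QE a : Q (u + a *: v) = q.[a] by rewrite (form_of_seq fB) -qE cats0.
have pq : p = q.
  apply: poly_eq_of_nat_values => i; rewrite -PE -QE; apply: PQ => t.
  rewrite -[(u + i%:R *: v) t]/(u t + i%:R * v t) uE vE.
  by rewrite addr_ge0 ?mulr_ge0// le_max lexx orbT.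
have -> : x = u + (-1) *: v.
  apply/continuousEP => t; rewrite -[RHS]/(u t + (-1) * v t) uE vE /Num.max.
  by case: ifPn; case: ifPn; rewrite -?leNgt; lra.
by rewrite PE QE pq.
Qed.

End uniqueness_of_forms.

Section power_integrals.
Context {R : realType} {K : ptopologicalType}.
Hypotheses (cK : compact [set: K]) (hK : hausdorff_space K).
Local Notation M := (regular_measure R K).
Local Notation C := (continuousType K R).
Implicit Types (mu nu : M) (x y : C).

Definition product_integral n mu (x : 'I_n -> C) : R :=
  charge_integral mu (fun t => \prod_(i < n) x i t).

Lemma form_of_power_integral n mu :
  form_of (power_integral n mu) (product_integral mu (n := n)).
Proof.
have prod_dfwith (x : 'I_n -> C) i w : (fun t => \prod_(j < n) (dfwith x i w) j t) =
    (fun t => w t * \prod_(j < n | j != i) x j t).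
  apply/funext => t; rewrite (bigD1 i)//= dfwithin; congr (_ * _).
  by apply: eq_bigr => j ji; rewrite dfwithout// eq_sym.
split.
- move=> i x a y z; rewrite /product_integral !prod_dfwith -(charge_integralD cK);
  [|by cts|by cts].
  congr charge_integral; apply/funext => t.
  by rewrite -[(a *: y + z) t]/(a * y t + z t); ring.
- exists (tv_norm mu) => x; apply: (charge_integral_le_variation cK); first by cts.
  move=> t; rewrite normr_prod; apply: ler_prod => i _.
  by rewrite normr_ge0 (C_norm_ub cK).
- move=> s x; congr charge_integral; apply/funext => t.
  by rewrite [RHS](reindex_inj (@perm_inj _ s)).
- move=> x; congr charge_integral; apply/funext => t.
  by rewrite prodr_const card_ord.
Qed.

Lemma power_integral_homogeneous n mu : homogeneous_polynomial n (power_integral n mu).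
Proof. by eexists; exact: form_of_power_integral. Qed.

(** Only the values on the positive cone matter: every nonnegative f is x ^ n for
    some x >= 0. *)
Lemma power_integral_le n mu nu : (0 < n)%N ->
  poly_le n (power_integral n mu) (power_integral n nu) <-> measure_le mu nu.
Proof.
move=> n0; split=> [[A [B [[_ _ _ PA] [_ _ _ QB] AB]]]|munu]; last first.
  exists (product_integral mu (n := n)), (product_integral nu (n := n)).
  split; [exact: form_of_power_integral|exact: form_of_power_integral|].
  move=> x x0; have /(measure_le_integral cK hK) := munu; apply.
  by split=> [|t]; [cts|apply: prodr_ge0].
apply/(measure_le_integral cK hK) => f [cf f0].
have cr := cts_root n0 cf.
have := AB (fun=> C_of (fun t => root_pos n (f t))); rewrite -PA -QB /power_integral.
rewrite (_ : (fun t => C_of _ t ^+ n) = f); last first.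
  by apply/funext => t; rewrite C_ofE// root_posK.
by apply => i t; rewrite C_ofE// root_pos_ge0.
Qed.

Lemma power_integral_opp n mu :
  (fun x => - power_integral n mu x) = power_integral n (- mu).
Proof.
apply/funext => x; have cx := @cts_fun _ _ x.
by apply/esym; apply: (charge_integral_opp cK) => //; cts.
Qed.

(** A majorant S of J mu and - J mu has a form B that dominates the absolute value
    of the form of J mu. With |h| <= 1 nearly the sign of mu, only the first
    variable needs to be split: x_0 = h^+ x_0 + h^- x_0 + (1 - |h|) x_0. *)
Lemma power_integral_abs n mu : (0 < n)%N ->
  is_poly_abs n (power_integral n mu) (power_integral n (M_abs mu)).
Proof.
case: n => // n _; have [le_abs ge_abs _] := join_abs mu.
split; first exact: power_integral_homogeneous.
- exact/power_integral_le.
- by rewrite power_integral_opp; exact/power_integral_le.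
move=> S _ [A1 [B [fA1 fB AB]]] [A2 [B' [fA2 fB' AB']]].
have eA1 := form_of_unique cK fA1 (form_of_power_integral n.+1 mu); subst A1.
have eB := form_of_unique cK fB' fB; subst B'.
rewrite power_integral_opp in fA2.
have eA2 := form_of_unique cK fA2 (form_of_power_integral n.+1 (- mu)); subst A2.
exists (product_integral (M_abs mu) (n := n.+1)), B.
split=> //; first exact: form_of_power_integral.
move=> x x0; rewrite /product_integral; set f := fun t => _.
have nf : nonneg_cts f by rewrite /f; split=> [|t]; [cts|apply: prodr_ge0].
have [cf f0] := nf; rewrite (M_abs_integral cK)//; apply/ler_addgt0Pr => e e0.
have [h [ch h1 le_h]] := variation_approx cK hK (rm_regular mu) nf e0.
pose with0 (g : K -> R) := dfwith x ord0 (C_of (fun t => g t * x ord0 t)).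
have cx0 := @cts_fun _ _ (x ord0).
have prod0 g : continuous g -> (fun t => \prod_(i < n.+1) with0 g i t) = (fun t =>
  g t * f t).
  move=> cg; apply/funext => t; rewrite /f (bigD1 ord0)//= [in RHS](bigD1 ord0)//= /with0
    dfwithin C_ofE; last by cts.
  rewrite mulrA; congr (_ * _); apply: eq_bigr => j j0.
  by rewrite dfwithout// eq_sym.
have with0_ge0 g : nonneg_cts g -> forall i t, 0 <= with0 g i t.
  move=> [cg g0] i t; rewrite /with0; have [->|i0] := eqVneq i ord0.
    by rewrite dfwithin C_ofE; [rewrite mulr_ge0|cts].
  by rewrite dfwithout// eq_sym.
have [mB _ _ _] := fB.
have BD g1 g2 : continuous g1 -> continuous g2 ->
    B (with0 (fun t => g1 t + g2 t)) = B (with0 g1) + B (with0 g2).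
  move=> cg1 cg2; rewrite /with0 -[B (dfwith x ord0 (C_of (fun t => g1 t * _)))]mul1r -mB.
  congr (B (dfwith _ _ _)); rewrite -C_ofD; [|by cts|by cts].
  by congr C_of; apply/funext => t; ring.
have B_abs g : nonneg_cts g -> `|charge_integral mu (fun t => g t * f t)| <= B (with0 g).
  move=> ng; have [cg _] := ng; rewrite ler_norml; apply/andP; split.
    have := AB' _ (with0_ge0 g ng); rewrite /product_integral prod0//.
    have cgf : continuous (fun t => g t * f t) by cts.
    have : charge_integral (- mu) (fun t => g t * f t) = - charge_integral mu (fun t =>
      g t * f t).
      exact: (charge_integral_opp cK).
    by move=> ->; rewrite lerNl.
  by have := AB _ (with0_ge0 g ng); rewrite /product_integral prod0.
pose hp t : R := Num.max (h t) 0; pose hn t : R := Num.max (- h t) 0.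
pose h0 t : R := 1 - (hp t + hn t).
have nhp : nonneg_cts hp by rewrite /hp; split=> [|t]; [cts|rewrite le_max lexx orbT].
have nhn : nonneg_cts hn by rewrite /hn; split=> [|t]; [cts|rewrite le_max lexx orbT].
have [[chp _] [chn _]] := (nhp, nhn).
have chpn : continuous (fun t => hp t + hn t) by cts.
have nh0 : nonneg_cts h0.
  rewrite /h0; split=> [|t]; first by cts.
  have := h1 t; rewrite ler_norml /hp /hn /Num.max.
  by case: ifPn; case: ifPn; rewrite -?leNgt; lra.
have -> : B x = B (with0 (fun t => hp t + hn t)) + B (with0 h0).
  rewrite -BD//; last by case: nh0.
  rewrite (_ : (fun t => hp t + hn t + h0 t) = fun=> 1); last first.
    by apply/funext => t; rewrite /h0; ring.
  congr B; rewrite /with0; apply/funext => i; have [->|i0] := eqVneq i ord0.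
    rewrite dfwithin; apply/continuousEP => t; rewrite C_ofE ?mul1r//.
    by cts.
  by rewrite dfwithout// eq_sym.
rewrite BD//; have := B_abs _ nhp; have := B_abs _ nhn; have := B_abs _ nh0.
have c1 : continuous (fun t => hn t * f t) by cts.
have c2 : continuous (fun t => hp t * f t) by cts.
have eq_h : charge_integral mu (fun t => f t * h t) =
    charge_integral mu (fun t => hp t * f t) - charge_integral mu (fun t => hn t * f t).
  rewrite addrC -mulN1r -(charge_integralD cK)//; congr charge_integral.
  apply/funext => t; have -> : h t = hp t - hn t; last by ring.
  by rewrite /hp /hn /Num.max; case: ifPn; case: ifPn; rewrite -?leNgt; lra.
move: le_h; rewrite eq_h !ler_norml => le_h /andP[? ?] /andP[? ?] /andP[? ?]; lra.
Qed.

Lemma poly_abs_power_integral n mu : (0 < n)%N ->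
  poly_abs n (power_integral n mu) = power_integral n (M_abs mu).
Proof.
move=> n0; have absP := power_integral_abs mu n0.
have := xgetI (fun=> 0) absP; rewrite -/(poly_abs _ _) => -[hQ le1 le2 least].
have [hA le3 le4 leastA] := absP.
by apply: (poly_le_anti cK); [exact: least|exact: leastA].
Qed.

End power_integrals.

(** * Norms *)

Section norms.
Context {R : realType} {K : ptopologicalType}.
Hypotheses (cK : compact [set: K]) (hK : hausdorff_space K).
Local Notation M := (regular_measure R K).
Local Notation C := (continuousType K R).
Implicit Types (mu nu : M) (x y : C) (P : C -> R).

Lemma poly_sup_norm_le P c : (forall x, C_norm x <= 1 -> `|P x| <= c) ->
  poly_sup_norm P <= c.
Proof.
move=> Pc; apply: ge_sup; last by move=> _ [x x1 <-]; exact: Pc.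
exists `|P 0|, 0 => //=; apply: C_norm_le => t.
by change (`|0 : R| <= 1); rewrite normr0.
Qed.

Lemma ball_power n x t : C_norm x <= 1 -> `|x t ^+ n| <= 1.
Proof.
move=> x1; rewrite normrX exprn_ile1//; exact: le_trans (C_norm_ub cK x t) x1.
Qed.

Lemma power_integral_ball n mu x : C_norm x <= 1 -> `|power_integral n mu x| <= tv_norm mu.
Proof.
move=> x1; rewrite -[tv_norm mu]mulr1; apply: (charge_integral_le_variation cK).
  by have cx := @cts_fun _ _ x; cts.
by move=> t; exact: ball_power.
Qed.

Lemma poly_sup_norm_ub n mu x : C_norm x <= 1 ->
  `|power_integral n mu x| <= poly_sup_norm (power_integral n mu).
Proof.
move=> x1; apply: ub_le_sup; last by exists x.
by exists (tv_norm mu) => _ [y y1 <-]; exact: power_integral_ball.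
Qed.

Let root_pos_le1 n (r : R) : (0 < n)%N -> r <= 1 -> root_pos n r <= 1.
Proof.
move=> n0 r1; have [r0|/ltW r0] := leP 0 r; last by rewrite root_pos0.
rewrite leNgt; apply/negP => lt1; have : 1 < root_pos n r ^+ n.
  by rewrite expr_gt1 ?root_pos_ge0.
by rewrite root_posK// ltNge r1.
Qed.

Lemma nonneg_power n (f : K -> R) : (0 < n)%N -> continuous f -> (forall t,
  0 <= f t <= 1) ->
  exists2 x : C, C_norm x <= 1 & (fun t => x t ^+ n) = f.
Proof.
move=> n0 cf f01; have cr := cts_root n0 cf.
exists (C_of (fun t => root_pos n (f t))).
  apply: C_norm_le => t; have /andP[f0 f1] := f01 t.
  by rewrite C_ofE// ger0_norm ?root_pos_ge0// root_pos_le1.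
by apply/funext => t; have /andP[f0 f1] := f01 t; rewrite C_ofE// root_posK.
Qed.

Lemma odd_power n (f : K -> R) : odd n -> continuous f -> (forall t, `|f t| <= 1) ->
  exists2 x : C, C_norm x <= 1 & (fun t => x t ^+ n) = f.
Proof.
move=> on cf f1; have n0 : (0 < n)%N by case: n on.
have cnf : continuous (fun t => - f t) by cts.
have c1 := cts_root n0 cf; have c2 := cts_root n0 cnf.
pose r t : R := root_pos n (f t) - root_pos n (- f t).
have cr : continuous r by rewrite /r; cts.
have rE t : r t ^+ n = f t /\ `|r t| <= 1.
  have := f1 t; rewrite ler_norml /r => /andP[f_ge f_le].
  have [f0|/ltW f0] := leP 0 (f t).
    rewrite [root_pos n (- _)]root_pos0 ?oppr_le0// subr0 root_posK//; split=> //.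
    by rewrite ger0_norm ?root_pos_ge0// root_pos_le1.
  rewrite [root_pos n (f t)]root_pos0// sub0r exprNn -signr_odd on expr1 root_posK
    ?oppr_ge0//.
  split; first by ring.
  by rewrite normrN ger0_norm ?root_pos_ge0// root_pos_le1// lerNl.
exists (C_of r).
  by apply: C_norm_le => t; rewrite C_ofE//; have [] := rE t.
by apply/funext => t; rewrite C_ofE//; have [] := rE t.
Qed.

(** For odd n the powers x ^ n of the unit ball fill the unit ball, which contains
    near-signs of mu. *)
Lemma sup_norm_odd n mu : odd n -> poly_sup_norm (power_integral n mu) = tv_norm mu.
Proof.
move=> on; apply/eqP; rewrite eq_le; apply/andP; split.
  by apply: poly_sup_norm_le => x; exact: power_integral_ball.
apply: (tv_norm_le cK hK) => f cf f1; have [x x1 xE] := odd_power on cf f1.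
by rewrite -xE; exact: poly_sup_norm_ub.
Qed.

Lemma max_normE mu :
  max_norm mu = Num.max (fine (charge_pos mu setT)) (fine (charge_neg mu setT)).
Proof.
rewrite /max_norm /tv_norm; congr (Num.max (fine _) (fine _)).
  by rewrite charge_abs_nonneg// => A mA; exact: (measure_ge0 (charge_pos mu)).
by rewrite charge_abs_nonneg// => A mA; exact: (measure_ge0 (charge_neg mu)).
Qed.

(** For even n the powers x ^ n of the unit ball are the functions with values in
    [0, 1]: these can select the positive or the negative set of mu, but not both with
    opposite signs. *)
Lemma sup_norm_even n mu : (0 < n)%N -> ~~ odd n ->
  poly_sup_norm (power_integral n mu) = max_norm mu.
Proof.
move=> n0 en; rewrite max_normE; apply/eqP; rewrite eq_le; apply/andP; split.
  apply: poly_sup_norm_le => x x1; have cx := @cts_fun _ _ x.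
  have cxn : continuous (fun t => x t ^+ n) by cts.
  have xn0 t : 0 <= x t ^+ n by exact: exprn_even_ge0.
  have bound (m : {finite_measure set (borel K) -> \bar R}) :
      0 <= \int[m]_t (x t ^+ n) <= fine (m setT).
    rewrite Rint_ge0//= -[fine _]mul1r -Rint_cst; apply: Rint_le => //;
      first exact: cts_cst.
    by move=> t; apply: le_trans (ler_norm _) (ball_power n t x1).
  have /andP[p0 p1] := bound (charge_pos mu); have /andP[q0 q1] := bound (charge_neg mu).
  rewrite /power_integral /charge_integral ler_norml; apply/andP; split.
    rewrite lerNl opprB; apply: (@le_trans _ _ (fine (charge_neg mu setT))); first lra.
    by rewrite le_max lexx orbT.
  apply: (@le_trans _ _ (fine (charge_pos mu setT))); first lra.
  by rewrite le_max lexx.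
rewrite ge_max; apply/andP; split; apply/ler_addgt0Pr => e e0.
  have [h [ch h01 le_h]] := positive_part_approx cK hK (rm_regular mu) e0.
  have [x x1 xE] := nonneg_power n0 ch h01.
  have := poly_sup_norm_ub n mu x1; rewrite {1}/power_integral xE ler_norml =>
    /andP[_ le_s].
  lra.
have [h [ch h01 le_h]] := negative_part_approx cK hK (rm_regular mu) e0.
have [x x1 xE] := nonneg_power n0 ch h01.
have := poly_sup_norm_ub n mu x1; rewrite {1}/power_integral xE ler_norml => /andP[le_s _].
lra.
Qed.

(** The absolute value is J of the variation of mu, a positive measure, and its
    supremum on the ball is attained at the constant 1. *)
Lemma reg_norm_power_integral n mu : (0 < n)%N ->
  poly_reg_norm n (power_integral n mu) = tv_norm mu.
Proof.
move=> n0; rewrite /poly_reg_norm (poly_abs_power_integral cK hK)// -(tv_norm_abs mu).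
apply/eqP; rewrite eq_le; apply/andP; split.
  by apply: poly_sup_norm_le => x; exact: power_integral_ball.
have one1 : C_norm (C_of (fun _ : K => 1 : R)) <= 1.
  by apply: C_norm_le => t; rewrite C_ofE ?normr1//; exact: cts_cst.
apply: le_trans (poly_sup_norm_ub n (M_abs mu) one1); apply: le_trans (ler_norm _).
rewrite tv_norm_abs /power_integral (_ : (fun t => _) = fun=> 1); last first.
  by apply/funext => t; rewrite C_ofE ?expr1n//; exact: cts_cst.
by rewrite (M_abs_integral cK) ?Rint_cst ?mul1r ?tv_normE//; exact: cts_cst.
Qed.

End norms.

Section isomorphism.
Context {R : realType} {K : ptopologicalType}.
Hypotheses (cK : compact [set: K]) (hK : hausdorff_space K).
Local Notation M := (regular_measure R K).
Local Notation C := (continuousType K R).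
Variables (n : nat) (n0 : (0 < n)%N).
Local Notation Jn := (J (R := R) cK n0).

Lemma oa_poly_eq (P Q : @oa_poly R K n) : oa_fun P = oa_fun Q -> P = Q.
Proof. by move=> PQ; apply: val_inj. Qed.

Lemma J_linear : linear Jn.
Proof.
move=> a mu nu; apply: oa_poly_eq; apply/funext => x.
have -> : oa_fun (a *: Jn mu + Jn nu) x = a * Jn mu x + Jn nu x by [].
have cx := @cts_fun _ _ x; apply: (M_integralD cK); cts.
Qed.

Lemma J_le mu nu : poly_le n (Jn mu) (Jn nu) <-> measure_le mu nu.
Proof. exact: (power_integral_le cK hK). Qed.

Lemma J_surjective P : exists mu, Jn mu = P.
Proof.
have /asboolP[hP oP] := oa_funP P.
have [mu muE] := orthogonally_additive_integral cK hK n0 hP oP.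
by exists mu; apply: oa_poly_eq; apply/funext => x; rewrite muE.
Qed.

Lemma J_bijective : bijective Jn.
Proof.
have J_inj : injective Jn.
  move=> mu nu eqJ; have refl la : poly_le n (Jn la) (Jn la) by apply/J_le => A mA.
  by apply: measure_le_anti; apply/J_le; rewrite eqJ.
have /choice[g gK] := J_surjective.
by exists g => // mu; apply: J_inj; rewrite gK.
Qed.

(** A polynomial that vanishes on the unit ball vanishes, by homogeneity. *)
Lemma sup_norm_is_norm : is_norm (fun P : @oa_poly R K n => poly_sup_norm P).
Proof.
have ub (P : @oa_poly R K n) x : C_norm x <= 1 -> `|P x| <= poly_sup_norm P.
  by have [mu <-] := J_surjective P; exact: (poly_sup_norm_ub cK).
have norm0 : C_norm (0 : C) <= 1.
  by apply: C_norm_le => t; change (`|0 : R| <= 1); rewrite normr0.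
have supZ (a : R) (P : @oa_poly R K n) : poly_sup_norm (a *: P) <= `|a| * poly_sup_norm P.
  apply: poly_sup_norm_le => x x1.
  by rewrite -[(a *: P) x]/(a * P x) normrM ler_wpM2l// ub.
split=> [P|P P0|a P|P Q].
- exact: le_trans (normr_ge0 _) (ub P 0 norm0).
- have [mu muP] := J_surjective P; apply: oa_poly_eq; apply/funext => x.
  pose a := (C_norm x + 1)^-1.
  have a1 : 0 < C_norm x + 1 by rewrite ltr_wpDl// (C_norm_ge0 cK).
  have a0 : 0 < a by rewrite invr_gt0.
  have ax1 : C_norm (a *: x) <= 1.
    apply: C_norm_le => t; rewrite -[(a *: x) t]/(a * x t) normrM gtr0_norm//.
    rewrite mulrC ler_pdivrMr// mul1r; apply: le_trans (C_norm_ub cK x t) _.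
    by rewrite lerDl.
  have := ub P _ ax1; rewrite P0 normr_le0 -muP => /eqP.
  have cx := @cts_fun _ _ x; have cxn : continuous (fun t => x t ^+ n) by cts.
  have -> : Jn mu (a *: x) = a ^+ n * Jn mu x.
    rewrite /= /power_integral.
    have c0 := @cts_cst R K 0; have := charge_integralD cK mu (a ^+ n) cxn c0.
    have -> : charge_integral mu (fun=> 0) = 0.
      by rewrite /charge_integral !Rint_cst; ring.
    rewrite addr0 => <-; congr charge_integral; apply/funext => t.
    by rewrite addr0 -exprMn.
  by move=> /eqP; rewrite mulf_eq0 expf_eq0 (gt_eqF a0) andbF/= => /eqP.
- apply/eqP; rewrite eq_le supZ/=.
  have [->|a_neq0] := eqVneq a 0.
    by rewrite normr0 mul0r; exact: le_trans (normr_ge0 _) (ub (0 *: P) 0 norm0).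
  rewrite -ler_pdivlMl ?normr_gt0// -normfV.
  by have := supZ a^-1 (a *: P); rewrite scalerA mulVf// scale1r.
- apply: poly_sup_norm_le => x x1; rewrite -[(P + Q) x]/(P x + Q x).
  by apply: le_trans (ler_normD _ _) _; rewrite lerD// ub.
Qed.

(** The norm axioms of the two norms on measures are inherited from the supremum
    norm: tv_norm for n = 1, max_norm for even n. *)
Lemma norm_pullback (N : M -> R) : (forall mu, poly_sup_norm (Jn mu) = N mu) -> is_norm N.
Proof.
move=> JN; have [N0 Neq0 NZ ND] := sup_norm_is_norm.
have [g JK _] := J_bijective; have linJ := J_linear.
have JD mu nu : Jn (mu + nu) = Jn mu + Jn nu by have := linJ 1 mu nu; rewrite !scale1r.
have J0 : Jn 0 = 0 by have := linJ (-1) 0 0; rewrite !scaleN1r addNr => ->; rewrite addNr.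
have JZ a mu : Jn (a *: mu) = a *: Jn mu by have := linJ a mu 0; rewrite J0 !addr0.
split=> [mu|mu|a mu|mu nu].
- by rewrite -JN.
- by rewrite -JN => /Neq0 Jmu; apply: (can_inj JK); rewrite J0.
- by rewrite -!JN JZ NZ.
- by rewrite -!JN JD ND.
Qed.

End isomorphism.

Lemma tv_norm_is_norm (R : realType) (K : ptopologicalType) (cK : compact [set: K])
  (hK : hausdorff_space K) : is_norm (fun mu : regular_measure R K => tv_norm mu).
Proof.
apply: (norm_pullback (cK := cK) hK (n := 1) (n0 := isT)) => mu.
exact: (sup_norm_odd cK hK).
Qed.

Lemma measure_banach_lattice (R : realType) (K : ptopologicalType) (cK : compact [set: K])
  (hK : hausdorff_space K) :
  banach_lattice (@measure_le R K) (fun mu : regular_measure R K => tv_norm mu).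
Proof.
split.
- exact: measure_vector_lattice.
- exact: tv_norm_is_norm.
- have join_unique (mu s : regular_measure R K) :
      is_join (@measure_le R K) mu (- mu) s -> s = M_abs mu.
    move=> [s1 s2 s_min]; have [a1 a2 a_min] := join_abs mu.
    by apply: measure_le_anti; [exact: s_min|exact: a_min].
  move=> mu nu s t /join_unique -> /join_unique -> le_st.
  by rewrite /tv_norm fine_le// ?fin_num_measure//; exact: (le_st setT).
- exact: tv_norm_complete.
Qed.

(** * The main theorem *)

Theorem theorem3 (R : realType) (K : ptopologicalType)
    (cK : compact [set: K]) (hK : hausdorff_space K) (n : nat) (n0 : (0 < n)%N) :
  let norm1 (mu : regular_measure R K) := tv_norm mu in
  let norm0 (mu : regular_measure R K) := max_norm mu in
  let sup_norm (P : @oa_poly R K n) := poly_sup_norm P in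
  let reg_norm (P : @oa_poly R K n) := poly_reg_norm n P in
  let Jn := J (R := R) cK n0 in
  [/\ banach_lattice_isometric_isomorphism
        (@measure_le R K) norm1 (fun P Q : @oa_poly R K n => poly_le n P Q)
        reg_norm Jn,
      odd n -> (forall P, reg_norm P = sup_norm P) /\
               isometric_isomorphism norm1 sup_norm Jn
    & ~~ odd n -> isometric_isomorphism norm0 sup_norm Jn].
Proof.
move=> norm1 norm0 sup_norm reg_norm Jn.
have linJ : linear Jn by exact: J_linear.
have bijJ : bijective Jn by exact: J_bijective.
have regJ mu : reg_norm (Jn mu) = norm1 mu by exact: (reg_norm_power_integral cK hK).
have normS : is_norm sup_norm by exact: (sup_norm_is_norm cK hK n0).
split=> [|on|en].
- apply: banach_lattice_transfer => //; first exact: measure_banach_lattice.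
  by move=> mu nu; exact: J_le.
- have supJ mu : sup_norm (Jn mu) = norm1 mu by exact: (sup_norm_odd cK hK).
  split; last by split=> //; exact: tv_norm_is_norm.
  by move=> P; have [mu <-] := J_surjective cK hK n0 P; rewrite regJ -supJ.
- have supJ mu : sup_norm (Jn mu) = norm0 mu by exact: (sup_norm_even cK hK).
  by split=> //; exact: (norm_pullback hK supJ).
Qed.
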